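(* Let $\mathsf{N},\mathsf{T},\mathsf{M}$ be positive integers with $(\mathsf{M}-1)\mathsf{T}+1\le \mathsf{N}\le \mathsf{M}\mathsf{T}$, and let $\eta>0$. For any $\epsilon>0$ and $\xi>0$ there exists a coding scheme $\mathcal{C}(\mathsf{N},\mathsf{T},\mathsf{M},\eta)$ that satisfies $\mathsf{T}$-node $\epsilon$-DP and has $$\mathtt{LMSE}(\mathcal{C})\le \frac{\eta^{\mathsf{M}}}{\left(1+\mathtt{SNR}^*(\epsilon)\right)^{\mathsf{M}}}+\xi.$$
   Context: Setting (distributed secure multiplication). There are $\mathsf{N}$ nodes and $\mathsf{M}$ real-valued inputs $A_1,\dots,A_{\mathsf{M}}$, which are mutually independent, have zero mean, and satisfy $\mathrm{Var}(A_i)\le\eta$. A coding scheme $\mathcal{C}(\mathsf{N},\mathsf{T},\mathsf{M},\eta)$ consists of (i) a joint distribution of real zero-mean noise variables $\{\tilde R_i^{(j)}\}_{i\in[\mathsf{M}],j\in[\mathsf{N}]}$, independent of the inputs, such that the families $\{\tilde R_1^{(j)}\}_{j},\dots,\{\tilde R_{\mathsf{M}}^{(j)}\}_{j}$ are mutually independent; and (ii) real decoding coefficients $d_1,\dots,d_{\mathsf{N}}$ (which may be chosen knowing the noise distribution and $\mathsf{N},\mathsf{T},\mathsf{M},\eta$). Node $j$ stores $\tilde A_i^{(j)}=A_i+\tilde R_i^{(j)}$ for $i\in[\mathsf{M}]$ and outputs $\tilde V^{(j)}=\prod_{i=1}^{\mathsf{M}}(A_i+\tilde R_i^{(j)})$;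 the decoder outputs $\tilde V=\sum_{j=1}^{\mathsf{N}} d_j\tilde V^{(j)}$. $\mathsf{T}$-node $\epsilon$-DP: for each $i\in[\mathsf{M}]$, all $a_0,a_1\in\mathbb{R}$ with $|a_0-a_1|\le1$, every $\mathcal{T}=\{t_1,\dots,t_{\mathsf{T}}\}\subseteq[\mathsf{N}]$ with $|\mathcal{T}|=\mathsf{T}$ and every Borel set $\mathcal{B}\subseteq\mathbb{R}^{\mathsf{T}}$, $\mathbb{P}\big((a_0+\tilde R_i^{(t_1)},\dots,a_0+\tilde R_i^{(t_{\mathsf{T}})})\in\mathcal{B}\big)\le e^{\epsilon}\,\mathbb{P}\big((a_1+\tilde R_i^{(t_1)},\dots,a_1+\tilde R_i^{(t_{\mathsf{T}})})\in\mathcal{B}\big)$. $\mathtt{LMSE}(\mathcal{C})=\sup \mathbb{E}\big[|\tilde V-\prod_{i=1}^{\mathsf{M}}A_i|^2\big]$, the supremum over all joint laws of $(A_1,\dots,A_{\mathsf{M}})$ with mutually independent zero-mean components of variance at most $\eta$; expectation over inputs and noise. Notation: $\mathtt{SNR}^*(\epsilon)=\eta/\sigma^*(\epsilon)^2$, where $\sigma^*(\epsilon)^2=\dfrac{2^{2/3}e^{-2\epsilon/3}(1+e^{-2\epsilon/3})+e^{-\epsilon}}{(1-e^{-\epsilon})^2}$. *)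

(* Defs.v *)
From HB Require Import structures.
From mathcomp Require Import all_boot all_order all_algebra.
From mathcomp Require Import all_classical all_reals all_analysis.
Set Implicit Arguments. Unset Strict Implicit. Unset Printing Implicit Defensive.
Import Order.TTheory GRing.Theory Num.Theory.
Import numFieldNormedType.Exports.
Local Open Scope classical_set_scope.
Local Open Scope ring_scope.

Definition sigma_star2 {R : realType} (eps : R) : R :=
  ((2 `^ (2/3)) * expR (- (2 * eps / 3)) * (1 + expR (- (2 * eps / 3)))
     + expR (- eps)) / (1 - expR (- eps)) ^+ 2.

Definition SNR_star {R : realType} (eta eps : R) : R := eta / sigma_star2 eps.

Definition gen_sigma {d} {Om : measurableType d} {R : realType} {K : Type}
  (X : K -> Om -> R) : set (set Om) :=
  <<s [set E | exists k (B : set R), measurable B /\ E = X k @^-1` B] >>.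

Definition mutually_independent {d} {Om : measurableType d} {R : realType}
  (P : probability Om R) (n : nat) (F : 'I_n -> set (set Om)) : Prop :=
  forall E : 'I_n -> set Om, (forall i, F i (E i)) ->
    P (\bigcap_(i in [set: 'I_n]) E i) = (\prod_(i < n) P (E i))%E.

Definition borel_Rn {R : realType} (T : nat) : set (set 'rV[R]_T) :=
  <<s [set U : set 'rV[R]_T | open U] >>.

(* A coding scheme C(N,T,M,eta): a probability space carrying the real noise
   variables Rn i j (i : input index, j : node index), and decoding
   coefficients dc. Validity: measurable, zero mean (integrable), and the
   families {Rn i j}_j, i : 'I_M, mutually independent. *)
Definition valid_noise {d} {Om : measurableType d} {R : realType}
  (P : probability Om R) (M N : nat) (Rn : 'I_M -> 'I_N -> Om -> R) : Prop :=
  (forall i j, measurable_fun setT (Rn i j)) /\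
  (forall i j, Rn i j \in Lfun P 1%:E /\ ('E_P[Rn i j] = 0)%E) /\
  mutually_independent P (fun i => gen_sigma (Rn i)).

Definition T_node_DP {d} {Om : measurableType d} {R : realType}
  (P : probability Om R) (M N T : nat) (Rn : 'I_M -> 'I_N -> Om -> R)
  (eps : R) : Prop :=
  forall (i : 'I_M) (a0 a1 : R), `|a0 - a1| <= 1 ->
  forall t : 'I_T -> 'I_N, injective t ->
  forall B : set 'rV[R]_T, @borel_Rn R T B ->
    (P [set w | B (\row_k (a0 + Rn i (t k) w))%R]
     <= (expR eps)%:E * P [set w | B (\row_k (a1 + Rn i (t k) w))%R])%E.

Definition valid_inputs {d} {Om : measurableType d} {R : realType}
  (P : probability Om R) (M : nat) (A : 'I_M -> Om -> R) (eta : R) : Prop :=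
  (forall i, measurable_fun setT (A i)) /\
  (forall i, A i \in Lfun P 2%:E /\ ('E_P[A i] = 0)%E /\
     (variance P (A i) <= eta%:E)%E) /\
  mutually_independent P (fun i => gen_sigma (fun _ : unit => A i)).

(* mean squared error for given inputs, inputs independent of noise
   (joint law = product of input law and noise law) *)
Definition mse {dA dR} {OmA : measurableType dA} {OmR : measurableType dR}
  {R : realType} (PA : probability OmA R) (PR : probability OmR R) (M N : nat)
  (A : 'I_M -> OmA -> R) (Rn : 'I_M -> 'I_N -> OmR -> R) (dc : 'I_N -> R)
  : \bar R :=
  (\int[PA \x PR]_w
     ((\sum_(j < N) dc j * \prod_(i < M) (A i w.1 + Rn i j w.2)
       - \prod_(i < M) A i w.1) ^+ 2)%:E)%E.

Definition LMSE {dR} {OmR : measurableType dR} {R : realType}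
  (PR : probability OmR R) (M N : nat) (Rn : 'I_M -> 'I_N -> OmR -> R)
  (dc : 'I_N -> R) (eta : R) : \bar R :=
  ereal_sup [set x | exists (dA : measure_display) (OmA : measurableType dA)
      (PA : probability OmA R) (A : 'I_M -> OmA -> R),
      valid_inputs PA A eta /\ x = mse PA PR A Rn dc].

(* Main.v *)
Require Import Defs.
From HB Require Import structures.
From mathcomp Require Import all_boot all_order all_algebra.
From mathcomp Require Import all_classical all_reals all_analysis.
From mathcomp Require Import measurable_realfun ring lra zify.
Set Implicit Arguments. Unset Strict Implicit. Unset Printing Implicit Defensive.
Import Order.TTheory GRing.Theory Num.Theory.
Import numFieldNormedType.Exports.
Local Open Scope classical_set_scope.
Local Open Scope ring_scope.

(* Node [j] evaluates, at a tiny negative point [y_j = - s (j+1)], the polynomials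
     p_i(y) = A_i + R_i (1 - y^T) + rho sum_(1 <= k < T) Z_(i,k) y^k,
   where [R_i] is staircase noise with privacy level slightly below [eps] and the
   [Z_(i,k)] are staircase noises with a tiny privacy level.

   Privacy: let [Q] be the monic polynomial of degree [T] vanishing at the [T]
   observed points.  Then [1 - Q / (1 + Q(0))] takes the value 1 at these points and
   is of the form [r (1 - y^T) + rho sum_k zeta_k y^k] with [0 < r <= 1] and [zeta_k]
   of order [s / rho].  Hence changing the input by [a0 - a1] is the same as shifting
   [R_i] and the [Z_(i,k)] by amounts at most 1, which costs a factor [exp eps].

   Accuracy: the decoder is a combination of the values [prod_i p_i(y_j)].  With [N]
   points it can prescribe the image of [y^m] for all [m < N], and the images of the
   higher powers tend to 0 with [s].  Since [p_i(1) ~ A_i], a target is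
     q |-> q(1) - (1-l)^M q(theta),   theta^T = 1/(1-l),   l = eta / (eta + sigma^2),
   which annihilates [y^(M T)], so that [N > (M-1) T] points suffice.  As [rho] tends
   to 0 the error becomes [prod_i ((1-l) A_i - l R_i)] up to sign, whose second moment
   is [(eta / (1 + eta / sigma^2))^M].  For fixed [s] and [rho] the error is expanded in
   products of the pairwise uncorrelated [A_i], [R_i], [Z_(i,k)], so its second moment
   is a sum of squares that increases with each variance of [A_i]. *)

(** * Products of probability spaces *)

Section binary_product.
Context {R : realType}.

Lemma integral_prod_mul d1 d2 (T1 : measurableType d1) (T2 : measurableType d2)
  (P1 : probability T1 R) (P2 : probability T2 R) (f : T1 -> R) (g : T2 -> R) :
  P1.-integrable setT (EFin \o f) -> P2.-integrable setT (EFin \o g) ->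
  (P1 \x P2)%E.-integrable setT (fun w => (f w.1 * g w.2)%:E) /\
  (\int[P1 \x P2]_w (f w.1 * g w.2)%:E =
    (\int[P1]_x (f x)%:E) * (\int[P2]_y (g y)%:E))%E.
Proof.
move=> intf intg.
have mf : measurable_fun setT f by apply/measurable_EFinP; case/integrableP: intf.
have mg : measurable_fun setT g by apply/measurable_EFinP; case/integrableP: intg.
have mfg : measurable_fun setT (fun w : T1 * T2 => (f w.1 * g w.2)%:E).
  apply/measurable_EFinP; apply: measurable_funM.
    exact: measurableT_comp mf measurable_fst.
  exact: measurableT_comp mg measurable_snd.
have int12 : (P1 \x P2)%E.-integrable setT (fun w => (f w.1 * g w.2)%:E).
  apply/(integrable12ltyP _ _ mfg) => /=.
  have -> : (\int[P1]_x \int[P2]_y `|f x * g y|%:E =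
      \int[P1]_x (`|f x|%:E * \int[P2]_y `|g y|%:E))%E.
    apply: eq_integral => x _.
    under eq_integral do rewrite normrM EFinM.
    rewrite ge0_integralZl_EFin//.
    by apply/measurable_EFinP; exact: measurableT_comp.
  case/integrableP: intf => _ hf; case/integrableP: intg => _ hg.
  rewrite ge0_integralZr//.
  - apply: lte_mul_pinfty => //; first exact: integral_ge0.
    by rewrite ge0_fin_numE//; exact: integral_ge0.
  - by apply/measurable_EFinP; exact: measurableT_comp.
  - exact: integral_ge0.
split=> //.
rewrite -integral12_prod_meas1//= /fubini_F /=.
have -> : (\int[P1]_x \int[P2]_y (f x * g y)%:E =
    \int[P1]_x ((f x)%:E * \int[P2]_y (g y)%:E))%E.
  apply: eq_integral => x _.
  under eq_integral do rewrite EFinM.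
  by rewrite integralZl.
by rewrite -(fineK (integrable_fin_num _ intg))// integralZr.
Qed.

(** Privacy costs multiply over independent factors. Section by section, the bound for [t] gives the
    factor [b]; what remains is an integral against the image of [P1] under [s], a measure dominated
    by [a] times [P1]. *)
Lemma product_shift d1 d2 (T1 : measurableType d1) (T2 : measurableType d2)
  (P1 : probability T1 R) (P2 : probability T2 R) (s : T1 -> T1) (t : T2 -> T2)
  (a b : R) : 0 <= a -> 0 <= b ->
  measurable_fun setT s -> measurable_fun setT t ->
  (forall S, measurable S -> P1 (s @^-1` S) <= a%:E * P1 S)%E ->
  (forall S, measurable S -> P2 (t @^-1` S) <= b%:E * P2 S)%E ->
  forall S, measurable S ->
  ((P1 \x P2) ((fun w => (s w.1, t w.2)) @^-1` S) <= (a * b)%:E * (P1 \x P2) S)%E.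
Proof.
move=> a0 b0 ms mt sP tP S mS.
rewrite /product_measure1 /=.
have mg : measurable_fun setT (P2 \o xsection S) by exact: measurable_fun_xsection.
apply: (@le_trans _ _ (\int[P1]_x (b%:E * (P2 \o xsection S) (s x)))%E).
  apply: ge0_le_integral => //.
  - have mst : measurable_fun setT (fun w : T1 * T2 => (s w.1, t w.2)).
      apply/measurable_fun_pairP; split.
        exact: measurableT_comp ms measurable_fst.
      exact: measurableT_comp mt measurable_snd.
    apply: measurable_fun_xsection.
    by rewrite -[X in measurable X]setTI; exact: mst.
  - by apply: measurable_funeM => //; exact: measurableT_comp mg ms.
  - move=> x _ /=.
    have := tP (xsection S (s x)) (measurable_xsection _ mS).
    by congr (P2 _ <= _)%E; rewrite !xsectionE.
rewrite ge0_integralZl_EFin//; last exact: measurableT_comp mg ms.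
rewrite mulrC EFinM -muleA lee_wpmul2l//.
pose sf : {mfun T1 >-> T1} := mfun_Sub (mem_set ms).
have -> : (\int[P1]_x (P2 \o xsection S) (s x) =
    \int[pushforward P1 sf]_x (P2 \o xsection S) x)%E.
  by rewrite ge0_integral_pushforward.
have -> : (a%:E * \int[P1]_x (P2 \o xsection S) x =
    \int[mscale (NngNum a0) P1]_x (P2 \o xsection S) x)%E.
  by rewrite ge0_integral_mscale.
exact: ge0_le_measure_integral.
Qed.

End binary_product.

(** The space is an iterated binary product, but only two features are exported: integrals of
    products factor, and coordinatewise maps that distort each factor boundedly lift to the whole
    space. Moments and independence follow from the first, privacy from the second. *)
Lemma exists_product_space (R : realType) d (T : measurableType d) n
    (mu : 'I_n -> probability T R) :
  exists d' (Om : measurableType d') (P : probability Om R) (X : 'I_n -> Om -> T),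
  [/\ forall i, measurable_fun setT (X i),
    forall f : 'I_n -> T -> R,
      (forall i, (mu i).-integrable setT (EFin \o f i)) ->
      P.-integrable setT (fun w => (\prod_i f i (X i w))%:E) /\
      (\int[P]_w (\prod_i f i (X i w))%:E = \prod_i \int[mu i]_x (f i x)%:E)%E &
    forall (s : 'I_n -> T -> T) (a : 'I_n -> R),
      (forall i, measurable_fun setT (s i)) -> (forall i, 0 <= a i) ->
      (forall i S, measurable S -> (mu i (s i @^-1` S) <= (a i)%:E * mu i S)%E) ->
      exists t : Om -> Om, [/\ measurable_fun setT t,
        forall i w, X i (t w) = s i (X i w) &
        forall S, measurable S -> (P (t @^-1` S) <= (\prod_i a i)%:E * P S)%E]].
Proof.
elim: n mu => [|n IH] mu.
  have X : 'I_0 -> unit -> T by case.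
  exists _, unit, (dirac tt), X; split.
  - by case.
  - move=> f _; split.
      under eq_fun do rewrite big_ord0.
      exact: finite_measure_integrable_cst.
    under eq_integral do rewrite big_ord0.
    rewrite integral_cst// big_ord0 mul1e; exact: (probability_setT (dirac tt)).
  - move=> s a _ _ _; exists id; split=> [|[]//|S mS]; first exact: measurable_id.
    by rewrite big_ord0 mul1e.
have [d' [Om [P [X [mX intX shiftX]]]]] := IH (mu \o lift ord0).
exists _, (T * Om)%type, (mu ord0 \x P)%E,
  (fun i w => if unlift ord0 i is Some j then X j w.2 else w.1); split.
- move=> i; case: unliftP => [j|] _.
    exact: measurableT_comp (mX j) measurable_snd.
  exact: measurable_fst.
- move=> f intf.
  have [intX1 intX2] := intX (f \o lift ord0) (fun i => intf (lift ord0 i)).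
  rewrite big_ord_recl.
  have -> : (\prod_(i < n) \int[mu (lift ord0 i)]_x (f (lift ord0 i) x)%:E =
    \int[P]_w (\prod_i f (lift ord0 i) (X i w))%:E)%E by rewrite intX2.
  have <- : (fun w => (f ord0 w.1 * \prod_i f (lift ord0 i) (X i w.2))%:E) =
    (fun w => (\prod_i f i (if unlift ord0 i is Some j then X j w.2 else w.1))%:E).
    apply/funext => w; rewrite big_ord_recl unlift_none; congr (_ * _)%:E.
    by apply: eq_bigr => i _; rewrite liftK.
  exact: integral_prod_mul.
- move=> s a ms a0 sa.
  have [t [mt Xt Pt]] := shiftX (s \o lift ord0) (a \o lift ord0)
    (fun i => ms _) (fun i => a0 _) (fun i => sa _).
  exists (fun w => (s ord0 w.1, t w.2)); split.
  + apply/measurable_fun_pairP; split.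
      exact: measurableT_comp (ms _) measurable_fst.
    exact: measurableT_comp mt measurable_snd.
  + by move=> i w; case: unliftP => [j ->|->] //=; rewrite Xt.
  + move=> S mS; rewrite big_ord_recl.
    have p0 : 0 <= \prod_(i < n) a (lift ord0 i) by apply: prodr_ge0 => i _.
    exact: (product_shift (a0 ord0) p0 (ms ord0) mt (sa ord0) Pt mS).
Qed.

(** * Moments, independence and orthogonality of coordinates *)

Section product_space_theory.
Context {R : realType} d d1 (Om : measurableType d) (T : measurableType d1).
Variables (P : probability Om R) (n : nat) (mu : 'I_n -> probability T R).
Variable (Y : 'I_n -> Om -> T).
Hypothesis integral_prod : forall f : 'I_n -> T -> R,
  (forall i, (mu i).-integrable setT (EFin \o f i)) ->
  P.-integrable setT (fun w => (\prod_i f i (Y i w))%:E) /\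
  (\int[P]_w (\prod_i f i (Y i w))%:E = \prod_i \int[mu i]_x (f i x)%:E)%E.

Lemma integral_coordinate i (g : T -> R) : (mu i).-integrable setT (EFin \o g) ->
  P.-integrable setT (fun w => (g (Y i w))%:E) /\
  (\int[P]_w (g (Y i w))%:E = \int[mu i]_x (g x)%:E)%E.
Proof.
move=> intg.
pose f j := if j == i then g else cst 1.
have intf j : (mu j).-integrable setT (EFin \o f j).
  rewrite /f; case: eqVneq => [->//|_].
  exact: finite_measure_integrable_cst.
have [fi fE] := integral_prod intf.
have fY w : \prod_j f j (Y j w) = g (Y i w).
  rewrite (bigD1 i)//= /f eqxx big1 ?mulr1// => j /negPf ->.
  by [].
have fYE : (fun w => (\prod_j f j (Y j w))%:E) = (fun w => (g (Y i w))%:E).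
  by apply/funext => w; rewrite fY.
split; first by rewrite -fYE.
rewrite -fYE fE (bigD1 i)//= /f eqxx big1 ?mule1// => j /negPf ->.
by rewrite /= integral_cst//= mul1e probability_setT.
Qed.

Lemma probability_coordinates (C : 'I_n -> set T) : (forall i, measurable (Y i @^-1` C i)) ->
  (forall i, measurable (C i)) ->
  P (\bigcap_(i in [set: 'I_n]) (Y i @^-1` C i)) = (\prod_(i < n) P (Y i @^-1` C i))%E.
Proof.
move=> mY mC.
have intC i : (mu i).-integrable setT (EFin \o (\1_(C i) : T -> R)).
  exact: integrable_indic.
transitivity (\prod_i \int[mu i]_x (\1_(C i) x)%:E)%E; last first.
  apply: eq_bigr => i _; rewrite -(integral_coordinate (intC i)).2.
  by rewrite -[in RHS](setIT (_ @^-1` _)) -integral_indic.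
rewrite -(integral_prod intC).2.
rewrite -[in LHS](setIT (\bigcap_(i in _) _)) -integral_indic//; last first.
  by apply: fin_bigcap_measurable => //; exact: finite_finset.
apply: eq_integral => w _; congr _%:E; rewrite indicE.
case: (boolP (w \in _)) => [|/negP]; rewrite inE => wC.
  by rewrite big1// => i _; rewrite indicE mem_set//; exact: wC.
have /existsNP[i /not_implyP[_ wCi]] := wC.
by rewrite (bigD1 i)//= indicE memNset// mul0r.
Qed.

(** Products of functions that are orthogonal in each coordinate are orthogonal: two different words
    differ at some letter, and that coordinate contributes a zero factor. Only the diagonal of the
    expanded square survives. *)
Lemma integral_sqr_tensor (L : finType) (phi : 'I_n -> L -> T -> R) (v : 'I_n -> L -> R)
    (e : {ffun 'I_n -> L} -> R) :
  (forall i o o', (mu i).-integrable setT (fun x => (phi i o x * phi i o' x)%:E)) ->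
  (forall i o o', (\int[mu i]_x (phi i o x * phi i o' x)%:E = ((o == o')%:R * v i o)%:E)%E) ->
  (\int[P]_w ((\sum_(f : {ffun 'I_n -> L}) e f * \prod_i phi i (f i) (Y i w)) ^+ 2)%:E =
    (\sum_(f : {ffun 'I_n -> L}) (\prod_i v i (f i)) * e f ^+ 2)%:E)%E.
Proof.
move=> intphi phiE.
pose p (f f' : {ffun 'I_n -> L}) w := \prod_i (phi i (f i) (Y i w) * phi i (f' i) (Y i w)).
have [pint pE] : (forall f f', P.-integrable setT (fun w => (p f f' w)%:E)) /\
    forall f f', (\int[P]_w (p f f' w)%:E = ((f == f')%:R * \prod_i v i (f i))%:E)%E.
  have H (f f' : {ffun 'I_n -> L}) := integral_prod (fun i => intphi i (f i) (f' i)).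
  split=> f f'; first exact: (H f f').1.
  rewrite (H f f').2 (eq_bigr (fun i => ((f i == f' i)%:R * v i (f i))%:E)) => [|i _]; last first.
    exact: phiE.
  rewrite prodEFin; congr _%:E; rewrite big_split /=; congr (_ * _).
  have [->|ff'] := eqVneq f f'; first by rewrite big1// => i _; rewrite eqxx.
  have /existsNP[i /eqP/negPf fi] : ~ forall i, f i = f' i.
    by move=> H'; move/eqP: ff'; apply; apply/ffunP.
  by rewrite (bigD1 i)//= fi mul0r.
have sqE w : (\sum_(f : {ffun 'I_n -> L}) e f * \prod_i phi i (f i) (Y i w)) ^+ 2 =
    \sum_(f : {ffun 'I_n -> L}) \sum_(f' : {ffun 'I_n -> L}) e f * e f' * p f f' w.
  rewrite expr2 mulr_suml; apply: eq_bigr => f _; rewrite mulr_sumr.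
  by apply: eq_bigr => f' _; rewrite /p big_split /= mulrACA.
under eq_integral do rewrite sqE -sumEFin.
have int1 f f' : P.-integrable setT (fun w => (e f * e f' * p f f' w)%:E).
  under eq_fun do rewrite EFinM.
  exact: integrableZl.
rewrite integral_sum//=; last first.
  move=> f; under eq_fun do rewrite -sumEFin.
  exact: integrable_sum.
rewrite -sumEFin; apply: eq_bigr => f _.
under eq_integral do rewrite -sumEFin.
rewrite integral_sum//= (bigD1 f)//= big1 ?adde0 => [|f' /negPf ff'].
  under eq_integral do rewrite EFinM.
  by rewrite integralZl// pE eqxx mul1r -EFinM; congr _%:E; ring.
under eq_integral do rewrite EFinM.
by rewrite integralZl// pE eq_sym ff' mul0r mule0.
Qed.

End product_space_theory.

(** * Independence of the inputs *)

(* Layer cake: [h x] is the length of [0, h x[, so by Tonelli the product rule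
   for the events [t < h (A w)] integrates to the one for [h \o A]. *)
Lemma ge0_integral_mul_indep (R : realType) d (Om : measurableType d)
    (P : probability Om R) (A : Om -> R) (g : Om -> \bar R) (h : R -> R) :
  measurable_fun setT A -> measurable_fun setT g -> measurable_fun setT h ->
  (forall w, 0 <= g w)%E -> (forall x, 0 <= h x) ->
  (forall B : set R, measurable B ->
    \int[P]_w (g w * (\1_B (A w))%:E) = \int[P]_w g w * P (A @^-1` B))%E ->
  (\int[P]_w (g w * (h (A w))%:E) = \int[P]_w g w * \int[P]_w (h (A w))%:E)%E.
Proof.
move=> mA mg mh g0 h0 gA.
have mhA : measurable_fun setT (h \o A) by exact: measurableT_comp.
pose GR := measurableTypeR R.
pose mu : {measure set GR -> \bar R} := @lebesgue_measure R.
pose D : set (Om * GR) := [set w | 0 <= (w.2 : R) < h (A w.1)].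
have mD : measurable D.
  have -> : D = [set w | ((0 : R)%:E <= (w.2 : R)%:E)%E] `&`
                [set w | ((w.2 : R)%:E < (h (A w.1))%:E)%E].
    apply/seteqP; split=> w /=; rewrite /D /= lee_fin lte_fin; first by move/andP.
    by move=> [? ?]; apply/andP.
  have m2 : measurable_fun setT (fun w : Om * GR => (w.2 : R)%:E).
    by apply/measurable_EFinP; exact: measurable_snd.
  have m1 : measurable_fun setT (fun w : Om * GR => (h (A w.1))%:E).
    by apply/measurable_EFinP; exact: measurableT_comp mhA measurable_fst.
  apply: measurableI.
    by rewrite -[X in measurable X]setTI; exact: measurable_lee.
  by rewrite -[X in measurable X]setTI; exact: measurable_lte.
pose Bt (t : R) : set R := [set x | 0 <= t < h x].
have mBt t : measurable (Bt t).
  have -> : Bt t = [set x | (0 <= t) && (t%:E < (h x)%:E)%E].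
    by apply/seteqP; split=> x.
  have [t0|t0] := leP 0 t => /=; last by rewrite set_false.
  by rewrite -[X in measurable X]setTI; apply: measurable_lte => //; exact/measurable_EFinP.
have measurable_1D : measurable_fun setT (fun w : Om * GR => (\1_D w)%:E : \bar R).
  by apply/measurable_EFinP; exact: measurable_indic.
have layer x : ((h (A x))%:E = \int[mu]_t (\1_D (x, t))%:E)%E.
  transitivity (\int[mu]_t (\1_(`[0, h (A x)[%classic : set R) t)%:E)%E; last first.
    apply: eq_integral => t _; rewrite !indicE; congr ((nat_of_bool _)%:R%:E).
  rewrite integral_indic// setIT.
  apply/esym; apply: etrans (lebesgue_measure_itv `[0, h (A x)[) _.
  rewrite /= lte_fin.
  by case: ltgtP (h0 (A x)) => // [_|<-]; rewrite ?sube0.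
have m1D : measurable_fun setT (fun t : GR => P (A @^-1` Bt t)).
  have -> : (fun t : GR => P (A @^-1` Bt t)) =
      fubini_G P (fun w : Om * GR => (\1_D w)%:E : \bar R).
    apply/funext => t; rewrite /fubini_G /=.
    transitivity (\int[P]_w (\1_(A @^-1` Bt t) w)%:E)%E; last by [].
    rewrite integral_indic ?setIT// -[X in measurable X]setTI.
    exact: mA.
  exact: measurable_fun_fubini_tonelli_G.
(* Stated for any such [g'], since it is used twice: for [g], and for the constant 1, which
   identifies the layer integral with the integral of [h (A w)]. *)
have key (g' : Om -> \bar R) : measurable_fun setT g' -> (forall w, 0 <= g' w)%E ->
  (forall B : set R, measurable B ->
    \int[P]_w (g' w * (\1_B (A w))%:E) = \int[P]_w g' w * P (A @^-1` B))%E ->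
  (\int[P]_w (g' w * (h (A w))%:E) =
    \int[P]_w g' w * \int[mu]_t P (A @^-1` Bt t))%E.
  move=> mg' g'0 g'A.
  have mgD : measurable_fun setT (fun w : Om * GR => (g' w.1 * (\1_D w)%:E)%E).
    apply: emeasurable_funM; first exact: measurableT_comp mg' measurable_fst.
    by apply/measurable_EFinP; exact: measurable_indic.
  transitivity (\int[P]_w \int[mu]_t (g' w * (\1_D (w, t))%:E))%E.
    apply: eq_integral => w _; rewrite layer ge0_integralZl//.
    exact: (measurable_fun_pair2 _ (measurable_1D)).
  rewrite (fubini_tonelli (m1 := P) (m2 := mu) (fun w => (g' w.1 * (\1_D w)%:E)%E))//; last first.
    by move=> w; rewrite mule_ge0.
  rewrite -ge0_integralZl//; last exact: integral_ge0.
  apply: eq_integral => t _.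
  by rewrite -g'A.
rewrite key// muleC -[RHS]muleC; congr (_ * _)%E.
have c1 : (\int[P]_w 1 = 1)%E.
  by rewrite integral_cst//= probability_setT mul1e.
have := key (cst 1%E); rewrite /= c1 !mul1e => <-.
- by apply: eq_integral => w _; rewrite mul1e.
- exact: measurable_cst.
- by [].
- move=> B mB; rewrite ?mul1e.
  transitivity (\int[P]_w (\1_(A @^-1` B) w)%:E)%E.
    by apply: eq_integral => w _; rewrite mul1e.
  rewrite integral_indic ?setIT// -[X in measurable X]setTI.
  exact: mA.
Qed.

(** Hybrid argument: [F k B] has [h] in the first [k] coordinates and indicators in the others. The
    case [k = 0] is independence of events, and each step trades one indicator for [h]. *)
Lemma ge0_integral_prod_indep (R : realType) d (Om : measurableType d)
    (P : probability Om R) n (A : 'I_n -> Om -> R) (h : 'I_n -> R -> R) :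
  (forall i, measurable_fun setT (A i)) ->
  (forall i, measurable_fun setT (h i)) -> (forall i x, 0 <= h i x) ->
  mutually_independent P (fun i => gen_sigma (fun _ : unit => A i)) ->
  (\int[P]_w (\prod_i h i (A i w))%:E = \prod_i \int[P]_w (h i (A i w))%:E)%E.
Proof.
move=> mA mh h0 indA.
pose F k (B : 'I_n -> set R) (i : 'I_n) (w : Om) : R :=
  if (i < k)%N then h i (A i w) else \1_(B i) (A i w).
have F0 k B i w : 0 <= F k B i w by rewrite /F; case: ifP.
have mF k B i : (forall j, measurable (B j)) -> measurable_fun setT (F k B i).
  move=> mB; rewrite /F; case: (i < k)%N; first exact: measurableT_comp (mh i) (mA i).
  exact: measurableT_comp (measurable_indic (mB i)) (mA i).
suff H k : forall B : 'I_n -> set R, (forall j, measurable (B j)) ->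
    (\int[P]_w (\prod_i F k B i w)%:E = \prod_i \int[P]_w (F k B i w)%:E)%E.
  have Fn i w : F n (fun=> setT) i w = h i (A i w) by rewrite /F ltn_ord.
  transitivity (\int[P]_w (\prod_i F n (fun=> setT) i w)%:E)%E.
    by apply: eq_integral => w _; congr _%:E; apply: eq_bigr => i _; rewrite Fn.
  rewrite H//; apply: eq_bigr => i _; apply: eq_integral => w _.
  by rewrite Fn.
elim: k => [|k IH] B mB.
  have mAB i : measurable (A i @^-1` B i).
    by rewrite -[X in measurable X]setTI; exact: mA.
  transitivity (P (\bigcap_(i in [set: 'I_n]) A i @^-1` B i)).
    rewrite -[in RHS](setIT (\bigcap_(i in _) _)) -integral_indic//; last first.
      by apply: fin_bigcap_measurable => //; exact: finite_finset.
    apply: eq_integral => w _; congr _%:E; rewrite indicE.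
    case: (boolP (w \in _)) => [|/negP]; rewrite inE => wB.
      by apply: big1 => i _; rewrite /F /= indicE mem_set//; exact: wB.
    have /existsNP[i /not_implyP[_ wBi]] := wB.
    by rewrite (bigD1 i)//= /F /= indicE memNset// mul0r.
  rewrite indA; last by move=> i; apply: sub_gen_smallest; exists tt, (B i).
  apply: eq_bigr => i _; rewrite -[X in P X]setIT -integral_indic//.
have [kn|nk] := ltnP k n; last first.
  have FE i w : F k.+1 B i w = F k B i w.
    by rewrite /F !(leq_trans (ltn_ord i))// (leq_trans nk).
  under eq_integral do under eq_bigr do rewrite FE.
  by rewrite IH//; apply: eq_bigr => i _; apply: eq_integral => w _; rewrite FE.
pose k0 := Ordinal kn.
pose g w := (\prod_(i | i != k0) F k B i w)%:E.
(* The induction hypothesis holds for all families [B], so the set at [k0] can be any [C]; this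
   gives the product rule for [g] against every event of [A k0]. *)
pose Bk (C : set R) i := if i == k0 then C else B i.
have mBk C : measurable C -> forall i, measurable (Bk C i).
  by move=> mC i; rewrite /Bk; case: ifP.
have kP C : measurable C -> (\int[P]_w (g w * (\1_C (A k0 w))%:E) =
    P (A k0 @^-1` C) * \prod_(i | i != k0) \int[P]_w (F k B i w)%:E)%E.
  have FC i w : F k (Bk C) i w =
      if i == k0 then \1_C (A k0 w) else F k B i w.
    rewrite /F /Bk; case: eqVneq => [->|]//=; by rewrite ltnn.
  move=> mC; have /esym := IH (Bk C) (mBk C mC).
  rewrite (bigD1 k0)//=.
  under eq_integral do rewrite FC eqxx.
  have mAC : measurable (A k0 @^-1` C).
    by rewrite -[X in measurable X]setTI; exact: mA.
  rewrite (_ : \int[P]_w (\1_C (A k0 w))%:E = P (A k0 @^-1` C))%E; last first.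
    by rewrite -[in RHS](setIT (_ @^-1` _)) -integral_indic.
  rewrite (eq_bigr (fun i => \int[P]_w (F k B i w)%:E)%E); last first.
    by move=> i /negPf ik; apply: eq_integral => w _; rewrite FC ik.
  move=> ->; apply: eq_integral => w _.
  rewrite (bigD1 k0)//= FC eqxx /g -EFinM mulrC; congr (_ * _)%:E.
  by apply: eq_bigr => i /negPf ik; rewrite FC ik.
have gE : (\int[P]_w g w = \prod_(i | i != k0) \int[P]_w (F k B i w)%:E)%E.
  have := kP setT measurableT.
  rewrite preimage_setT probability_setT mul1e => <-.
  by apply: eq_integral => w _; rewrite indicE in_setT mule1.
have Fk1 i w : F k.+1 B i w = if i == k0 then h k0 (A k0 w) else F k B i w.
  rewrite /F ltnS leq_eqVlt -val_eqE /=.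
  by have [ik|] := eqVneq (val i) k => //=; rewrite (_ : i = k0)//; exact: val_inj.
transitivity (\int[P]_w (g w * (h k0 (A k0 w))%:E))%E.
  apply: eq_integral => w _; rewrite (bigD1 k0)//= Fk1 eqxx /g -EFinM mulrC.
  by congr (_ * _)%:E; apply: eq_bigr => i /negPf ik; rewrite Fk1 ik.
rewrite ge0_integral_mul_indep//.
- rewrite gE [RHS](bigD1 k0)//= muleC; congr (_ * _)%E.
    by apply: eq_integral => w _; rewrite Fk1 eqxx.
  by apply: eq_bigr => i /negPf ik; apply: eq_integral => w _; rewrite Fk1 ik.
- apply/measurable_EFinP; under eq_fun do rewrite -big_filter.
  by apply: measurable_prod => i _; exact: mF.
- by move=> w; rewrite lee_fin; apply: prodr_ge0 => i _.
- by move=> C mC; rewrite kP// gE muleC.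
Qed.

(** * Staircase noise *)

Section staircase.
Context {R : realType}.
Local Notation mu := (@lebesgue_measure R).

Lemma lebesgue_measure_shift (r : R) (S : set R) : measurable S ->
  mu ((fun x => x + r) @^-1` S) = mu S.
Proof.
move=> mS.
rewrite -[LHS]/(pushforward mu ((fun x => x + r) : _ -> measurableTypeR R) S).
apply/esym/lebesgue_measure_unique => //=.
  exact: measurable_funD.
move=> mf _ [[a b]] _ <-.
rewrite /pushforward.
have -> : (fun x => x + r) @^-1` `]a, b]%classic = `](a - r), (b - r)]%classic.
  by apply/seteqP; split=> x /=; rewrite !in_itv /= ltrBlDr lerBrDr.
rewrite !lebesgue_measure_itv/= !lte_fin ltrD2r.
by case: ifP => // _; rewrite -!EFinD; congr _%:E; ring.
Qed.

Lemma integral_sqr_sym (r : R) : 0 < r ->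
  (\int[mu]_(x in `[(- r)%R, r]) (x ^+ 2)%:E = (2 / 3 * r ^+ 3)%:E)%E.
Proof.
move=> r0.
pose p : {poly R} := (3^-1) *: 'X^3.
have pE x : p.[x] = x ^+ 3 / 3 by rewrite /p hornerZ hornerXn mulrC.
apply: etrans (@continuous_FTC2 R (fun x => x ^+ 2) (horner p) (- r) r _ _ _ _) _.
- by rewrite gtrN.
- by apply: continuous_subspaceT => x; exact: exprn_continuous.
- split=> [x _||].
  + exact: derivable_horner.
  + exact/cvg_at_right_filter/continuous_horner.
  + exact/cvg_at_left_filter/continuous_horner.
- move=> x _; rewrite -derivE /p derivZ derivXn hornerZ.
  by rewrite hornerMn hornerXn; field.
- by rewrite !pE -EFinB; congr _%:E; field.
Qed.

Lemma series_arith_geo_cvg (b x : R) : 0 <= b < 1 ->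
  (\sum_(0 <= k < n) b ^+ k * (k%:R + x)) @[n --> \oo] -->
    x / (1 - b) + b / (1 - b) ^+ 2.
Proof.
move=> /andP[b0 b1].
have nb : 1 - b != 0 by rewrite gt_eqF// subr_gt0.
(* Closed form of the partial sums, checked by induction; the subtracted remainder carries the
   factor [b ^+ n]. *)
have -> : (fun n => \sum_(0 <= k < n) b ^+ k * (k%:R + x)) =
  (fun n => (x / (1 - b) + b / (1 - b) ^+ 2) -
     (b ^+ n * n%:R / (1 - b) + b ^+ n * (x / (1 - b) + b / (1 - b) ^+ 2))).
  apply/funext; elim=> [|n IH]; first by rewrite big_geq// expr0 mulr0 mul0r add0r mul1r subrr.
  by rewrite big_nat_recr//= IH (exprS b n) -natr1; field.
rewrite -[X in _ --> X]subr0; apply: cvgB; first exact: cvg_cst.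
have bn : (b ^+ n) @[n --> \oo] --> (0 : R) by apply: cvg_expr; rewrite ger0_norm.
rewrite -[X in _ --> X]addr0 -{1}(mul0r (1 - b)^-1).
rewrite -{2}(mul0r (x / (1 - b) + b / (1 - b) ^+ 2)).
apply: cvgD; apply: cvgM => //; try exact: cvg_cst.
(* [n b^n] is a geometric sequence of ratio [sqrt b] times a bounded one. *)
pose s := Num.sqrt b.
have s0 : 0 <= s by exact: sqrtr_ge0.
have s1 : s < 1 by rewrite -sqrtr1 ltr_sqrt.
have sn n : s ^+ n * n%:R <= (1 - s)^-1.
  rewrite -[leRHS]mul1r ler_pdivlMr ?subr_gt0//.
  have : (1 - s) * (\sum_(i < n) s ^+ i) <= 1.
    by rewrite -opprB mulNr -subrX1 opprB gerBl exprn_ge0.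
  apply: le_trans; rewrite mulrC ler_wpM2l ?subr_ge0 1?(ltW s1)//.
  rewrite mulr_natr -[X in s ^+ n *+ X]card_ord -sumr_const.
  apply: ler_sum => i _; apply: ler_wiXn2l => //; [exact: ltW|exact: ltnW].
apply: (@squeeze_cvgr _ _ _ _ (cst 0) (fun n => s ^+ n * (1 - s)^-1)).
- near=> n; apply/andP; split; first by rewrite mulr_ge0// exprn_ge0.
  by rewrite -{1}(sqr_sqrtr b0) -/s exprAC expr2 -mulrA ler_wpM2l// exprn_ge0.
- exact: cvg_cst.
- rewrite -(mul0r (1 - s)^-1); apply: cvgM; last exact: cvg_cst.
  by apply: cvg_expr; rewrite ger0_norm.
Unshelve. all: by end_near.
Qed.

(** Normalisation packages a measure of total mass 1 as a probability without changing its
    values. *)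
Lemma mnormalize_id d (T : measurableType d) (m : {measure set T -> \bar R})
  (P : probability T R) (S : set T) : m setT = 1%E -> mnormalize m P S = m S.
Proof. by rewrite /mnormalize => ->; rewrite onee_eq0/= invr1 mule1. Qed.

(* Each unnormalised weight is that of the uniform law on [-(k+g), k+g] times
   its length, so that the density decreases by the factor [b] at each step. *)
Lemma exists_staircase_prob (b g : R) : 0 < b < 1 -> 0 < g ->
  exists P : probability (measurableTypeR R) R,
  [/\ forall (r : R) (S : set R), `|r| <= 1 -> measurable S ->
        (P ((fun x => (x + r)%R) @^-1` S) <= b^-1%:E * P S)%E,
    forall S : set R, measurable S -> P ((fun x => (- x)%R) @^-1` S) = P S &
    (\int[P]_x (x ^+ 2)%:E <= (((g + b / (1 - b)) ^+ 2 + 3 * b / (1 - b) ^+ 2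
       + b * (1 + b) / ((1 - b) ^+ 3 * (g + b / (1 - b)))) / 3)%:E)%E].
Proof.
move=> /andP[b0 b1] g0.
have nb0 : 0 < 1 - b by rewrite subr_gt0.
have nb : 1 - b != 0 by rewrite gt_eqF.
pose r k : R := k%:R + g.
have r0 k : 0 < r k by rewrite ltr_wpDl.
have rr k : - r k < r k by rewrite gtrN.
(* The sum of the series with terms [b ^+ k * (2 * r k)], so that the weights [w] add up to 1. *)
pose Z : R := 2 * (g / (1 - b) + b / (1 - b) ^+ 2).
have Z0 : 0 < Z by rewrite mulr_gt0// addr_gt0// divr_gt0// exprn_gt0.
pose w k : R := b ^+ k * (2 * r k) / Z.
have w0 k : 0 <= w k.
  apply: divr_ge0; last exact: ltW.
  by apply: mulr_ge0; [rewrite exprn_ge0// ltW|rewrite mulr_ge0// ltW].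
have bZ0 k : 0 <= b ^+ k / Z by rewrite divr_ge0 ?exprn_ge0 ?(ltW b0) ?(ltW Z0).
pose I k : set R := `[- r k, r k]%classic.
have mI (S : set R) k : measurable S -> measurable (S `&` I k).
  by move=> mS; apply: measurableI => //; exact: measurable_itv.
pose nu := mseries (fun k => mscale (NngNum (w0 k)) (uniform_prob (rr k))) 0.
have UE k S : measurable S -> (uniform_prob (rr k) S = (2 * r k)^-1%:E * mu (S `&` I k))%E.
  move=> mS; rewrite -[X in uniform_prob _ X]setIT -integral_indic//.
  rewrite integral_uniform//; last first.
    by apply/measurable_EFinP; exact: measurable_indic.
  by rewrite integral_indic// opprK -mulr2n mulr_natl.
have nuE S : measurable S -> nu S = (\sum_(k <oo) (b ^+ k / Z)%:E * mu (S `&` I k))%E.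
  move=> mS; apply: eq_eseriesr => k _.
  rewrite -[LHS]/((w k)%:E * uniform_prob (rr k) S)%E UE// muleA -EFinM.
  congr (_%:E * _)%E; rewrite /w; field.
  by rewrite gt_eqF// gt_eqF.
have muI k : mu (I k) = (2 * r k)%:E.
  by rewrite lebesgue_measure_itv/= lte_fin rr -EFinB opprK -mulr2n mulr_natl.
have nuT : nu setT = 1%E.
  rewrite nuE//.
  transitivity (\sum_(k <oo) (2 / Z * (b ^+ k * r k))%:E)%E.
    apply: eq_eseriesr => k _; rewrite setTI muI -EFinM; congr _%:E; field.
    by rewrite gt_eqF.
  have -> : (fun n => \sum_(0 <= k < n) (2 / Z * (b ^+ k * r k))%:E)%E =
      EFin \o (fun n => 2 / Z * \sum_(0 <= k < n) b ^+ k * r k).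
    by apply/funext => n; rewrite sumEFin /= -mulr_sumr.
  have cv : (2 / Z * \sum_(0 <= k < n) b ^+ k * r k) @[n --> \oo] --> (1 : R).
    rewrite [X in _ --> X](_ : _ = 2 / Z * (g / (1 - b) + b / (1 - b) ^+ 2)); last first.
      by rewrite mulrAC mulfV// gt_eqF.
    apply: cvgMl_tmp.
    by apply: series_arith_geo_cvg; rewrite ltW.
  by rewrite EFin_lim; [rewrite (cvg_lim _ cv)|exact: cvgP cv].
(* A shift by at most 1 moves [I k] into [I k.+1], whose coefficient is smaller by the factor [b].
   Comparing term [k] with term [k.+1] therefore costs [b^-1]. *)
have shift (s : R) (S : set R) : `|s| <= 1 -> measurable S ->
    (nu ((fun x => (x + s)%R) @^-1` S) <= b^-1%:E * nu S)%E.
  move=> s1 mS.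
  have mS' (V : set R) : measurable V -> measurable ((fun x => (x + s)%R) @^-1` V).
    move=> mV; rewrite -[X in measurable X]setTI.
    exact: (measurable_funD (@measurable_id _ _ setT) (measurable_cst s)).
  rewrite !nuE//; last exact: mS'.
  pose u k := ((b ^+ k / Z)%:E * mu (S `&` I k))%E.
  have u0 k : (0 <= u k)%E.
    by rewrite mule_ge0// lee_fin bZ0.
  apply: (@le_trans _ _ (\sum_(k <oo) b^-1%:E * u (k + 1)%N)%E).
    apply: lee_nneseries => [k _ _|k _].
      by rewrite mule_ge0// lee_fin bZ0.
    rewrite /u muleA -EFinM addn1 exprS.
    have -> : b^-1 * (b * b ^+ k / Z) = b ^+ k / Z.
      by field; rewrite !gt_eqF.
    apply: lee_pmul => //; first by rewrite lee_fin bZ0.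
    rewrite -(lebesgue_measure_shift s (S := S `&` I k.+1)); last exact: mI.
    apply: le_measure; rewrite ?inE.
    - by apply: mI; exact: mS'.
    - by apply: mS'; exact: mI.
    - move=> x [Sx]; rewrite /I /= !in_itv /= /r -natr1 => /andP[xl xr].
      split=> //=; rewrite ?in_itv /=.
      by move: s1; rewrite ler_norml => /andP[? ?]; apply/andP; split; lra.
  rewrite nneseriesZl//; apply: lee_pmul => //.
  - by rewrite lee_fin invr_ge0 ltW.
  - by apply: nneseries_ge0.
  rewrite (nneseries_addn 1)//.
  have -> : (\sum_(k <oo) (b ^+ k / Z)%:E * mu (S `&` I k) =
      u 0%N + \sum_(1 <= k <oo) u k)%E by rewrite -nneseries_recl.
  by rewrite leeDr.
have sym (S : set R) : measurable S -> nu ((fun x => (- x)%R) @^-1` S) = nu S.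
  move=> mS.
  have mN : measurable ((fun x : R => (- x)%R) @^-1` S).
    by rewrite -[X in measurable X]setTI; exact: (measurable_funN (@measurable_id _ _ setT)).
  rewrite !nuE//; apply: eq_eseriesr => k _; congr (_ * _)%E.
  rewrite -[in RHS]lebesgue_measureN; last exact: mI.
  rewrite /pushforward; congr (mu _).
  by apply/seteqP; split=> x [Sx]; rewrite /I /= !in_itv /= => /andP[? ?];
    split=> //=; rewrite ?in_itv /=; apply/andP; split; lra.
have mom : (\int[nu]_x (x ^+ 2)%:E = \sum_(k <oo) (2 / 3 / Z * (b ^+ k * r k ^+ 3))%:E)%E.
  have mx2 : measurable_fun setT (fun x : measurableTypeR R => ((x : R) ^+ 2)%:E).
    by apply/measurable_EFinP; exact: measurable_funX.
  have x20 (x : R) : (0 <= (x ^+ 2)%:E)%E by rewrite lee_fin sqr_ge0.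
  rewrite ge0_integral_measure_series//; apply: eq_eseriesr => k _.
  rewrite ge0_integral_mscale//= integral_uniform//.
  rewrite integral_sqr_sym// -!EFinM; congr _%:E; rewrite /w opprK; field.
  by rewrite !gt_eqF // addr_gt0.
pose D : probability (measurableTypeR R) R := dirac ((0 : R) : measurableTypeR R).
exists (mnormalize nu D).
have PE S : mnormalize nu D S = nu S.
  exact: mnormalize_id.
split.
- move=> s S s1 mS; have := shift s S s1 mS.
  by rewrite -[X in (X <= _)%E]PE -[X in (_ <= _ * X)%E]PE.
- by move=> S mS; have := sym S mS; rewrite -!PE.
rewrite (eq_measure_integral nu); last by move=> S mS _; exact: PE.
rewrite mom.
apply: lime_le.
  apply: is_cvg_ereal_nneg_natsum => k _; rewrite lee_fin mulr_ge0//.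
    by rewrite divr_ge0// ltW.
  by rewrite mulr_ge0// exprn_ge0// ltW.
(* The sum over all [k] of [2 / 3 * b ^+ k * (k%:R + x) ^+ 3]. The partial sums are then
   differences, with remainder [b ^+ n * q (r n)]. *)
pose q x := 2 / 3 * (x ^+ 3 / (1 - b) + 3 * x ^+ 2 * b / (1 - b) ^+ 2 +
  3 * x * b * (1 + b) / (1 - b) ^+ 3 + b * (1 + 4 * b + b ^+ 2) / (1 - b) ^+ 4).
have q0 k : 0 <= q (r k).
  have ? := ltW b0; have ? := ltW (r0 k); have ? := ltW nb0.
  by rewrite /q; repeat first
    [done|apply: mulr_ge0|rewrite invr_ge0|apply: exprn_ge0|apply: addr_ge0].
have sq n : \sum_(0 <= k < n) 2 / 3 / Z * (b ^+ k * r k ^+ 3) =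
    (q g - b ^+ n * q (r n)) / Z.
  elim: n => [|n IH].
    by rewrite big_geq// expr0 mul1r /r add0r subrr mul0r.
  rewrite big_nat_recr//= IH (exprS b n) /q /r -natr1; field.
  by rewrite nb gt_eqF.
apply: nearW => n; rewrite sumEFin lee_fin sq.
apply: (@le_trans _ _ (q g / Z)).
  by rewrite ler_wpM2r ?invr_ge0 ?(ltW Z0)// gerBl mulr_ge0// exprn_ge0// ltW.
rewrite le_eqVlt; apply/orP; left; apply/eqP.
have gb : g * (1 - b) + b != 0 by rewrite gt_eqF// addr_gt0// mulr_gt0.
rewrite /q /Z; field.
by rewrite nb gb.
Qed.

(** The second moment bound of the staircase law for [b = c ^+ 3] and inner half-width
    [(c - c ^+ 3) / (1 - c ^+ 3)]; the privacy level [eps] corresponds to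
    [c = expR (- (eps / 3))]. *)
Definition staircase_variance (c : R) : R :=
  (c ^+ 2 * (2 + c ^+ 3) / 3 + c ^+ 3) / (1 - c ^+ 3) ^+ 2.

Lemma exists_dp_noise (eps : R) : 0 < eps ->
  exists P : probability (measurableTypeR R) R,
  [/\ forall (r : R) (S : set R), `|r| <= 1 -> measurable S ->
        (P ((fun x => (x + r)%R) @^-1` S) <= (expR eps)%:E * P S)%E,
    P.-integrable setT (fun x => (x : R)%:E), (\int[P]_x (x : R)%:E = 0)%E,
    P.-integrable setT (fun x => ((x : R) ^+ 2)%:E) &
    (\int[P]_x ((x : R) ^+ 2)%:E <= (staircase_variance (expR (- (eps / 3))))%:E)%E].
Proof.
move=> eps0; set c := expR (- (eps / 3)).
have c0 : 0 < c by exact: expR_gt0.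
have c1 : c < 1 by rewrite /c expR_lt1 oppr_lt0 divr_gt0.
have b1 : c ^+ 3 < 1 by rewrite exprn_ilt1// ltW.
have nb0 : 0 < 1 - c ^+ 3 by rewrite subr_gt0.
have nb : 1 - c ^+ 3 != 0 by rewrite gt_eqF.
have cb : c ^+ 3 = expR (- eps).
  by rewrite -expRM_natl; congr expR; field.
(* Minimizing the variance would ask for [g = (w - c^3) / (1 - c^3)] with
   [w^3 = c^3 (1 + c^3) / 2]; [w = c] is within the slack of [sigma_star2]. *)
pose g := (c - c ^+ 3) / (1 - c ^+ 3).
have g0 : 0 < g.
  by rewrite divr_gt0// subr_gt0 exprS gtr_pMr// exprn_ilt1// ltW.
have [|P [dpP symP momP]] := exists_staircase_prob (b := c ^+ 3) _ g0.
  by rewrite b1 andbT exprn_gt0.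
have gE : g + c ^+ 3 / (1 - c ^+ 3) = c / (1 - c ^+ 3).
  by rewrite /g -mulrDl subrK.
have mx : measurable_fun setT (fun x : measurableTypeR R => (x : R)%:E : \bar R).
  by apply/measurable_EFinP; exact: measurable_id.
have mx2 : measurable_fun setT (fun x : measurableTypeR R => ((x : R) ^+ 2)%:E : \bar R).
  by apply/measurable_EFinP; exact: measurable_funX.
have int2 : P.-integrable setT (fun x => ((x : R) ^+ 2)%:E).
  apply/integrableP; split=> //.
  under eq_integral do rewrite gee0_abs ?lee_fin ?sqr_ge0//.
  exact: le_lt_trans momP (ltry _).
have le_sqr (x : R) : `|x| <= 1 + x ^+ 2.
  by rewrite ler_norml; apply/andP; split; nra.
have int1 : P.-integrable setT (fun x => (x : R)%:E).
  apply: (@le_integrable _ _ _ P setT measurableT _ (fun x => (1 + (x : R) ^+ 2)%:E)) => //.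
    by move=> x _; rewrite /= lee_fin [leRHS]ger0_norm ?addr_ge0 ?sqr_ge0//.
  under eq_fun do rewrite EFinD.
  apply: integrableD => //.
  exact: finite_measure_integrable_cst.
have nmeas : measurable_fun setT ((fun x : R => - x) : measurableTypeR R -> measurableTypeR R).
  exact: (measurable_funN (@measurable_id _ _ setT)).
exists P; split=> //.
- by move=> r S r1 mS; have := dpP r S r1 mS; rewrite cb -expRN opprK.
(* By symmetry the mean equals its own opposite. *)
- have : (\int[P]_x (x : R)%:E = (-1)%:E * \int[P]_x (x : R)%:E)%E.
    rewrite -integralZl//.
    transitivity (\int[pushforward P
      ((fun x : R => (- x)%R) : _ -> measurableTypeR R)]_x (x : R)%:E)%E.
      by apply: eq_measure_integral => S mS _; first [exact: symP|exact/esym/symP].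
    have intN : P.-integrable setT (fun x => (- (x : R))%:E).
      by have := integrableN int1.
    rewrite integral_pushforward//.
    by apply: eq_integral => x _; rewrite mulN1e.
  rewrite -(fineK (integrable_fin_num _ int1))// -EFinM mulN1r => -[/eqP].
  by rewrite -addr_eq0 -mulr2n mulrn_eq0 /= => /eqP ->.
- apply: le_trans momP _; rewrite lee_fin gE /staircase_variance.
  rewrite le_eqVlt; apply/orP; left; apply/eqP; field.
  by rewrite nb gt_eqF.
Qed.

(** At [eps] itself the inequality is strict, so by continuity it survives at a slightly smaller
    level. The budget saved in this way pays for the masking noises. *)
Lemma staircase_variance_lt (eps : R) : 0 < eps ->
  exists eps' : R, 0 < eps' < eps /\
    staircase_variance (expR (- (eps' / 3))) <= sigma_star2 eps.
Proof.
move=> eps0.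
have lt0 : staircase_variance (expR (- (eps / 3))) < sigma_star2 eps.
  set c := expR (- (eps / 3)).
  have c0 : 0 < c by exact: expR_gt0.
  have c1 : c < 1 by rewrite /c expR_lt1 oppr_lt0 divr_gt0.
  have c2E : expR (- (2 * eps / 3)) = c ^+ 2.
    by rewrite -expRM_natl; congr expR; field.
  have c3E : expR (- eps) = c ^+ 3.
    by rewrite -expRM_natl; congr expR; field.
  have c3 : c ^+ 3 < 1 by rewrite exprn_ilt1// ltW.
  rewrite /staircase_variance /sigma_star2 c2E c3E ltr_pM2r; last first.
    by rewrite invr_gt0 exprn_gt0// subr_gt0.
  rewrite ltrD2r.
  have p1 : 1 <= (2 : R) `^ (2 / 3).
    by rewrite -[leLHS](powRr0 2) ler_powR// ler1n.
  have c20 : 0 < c ^+ 2 by rewrite exprn_gt0.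
  (* The strict gain is [(2 + c ^+ 3) / 3 < 1 + c ^+ 2], while the power of 2 is bounded below by
     1. *)
  apply: (@lt_le_trans _ _ (c ^+ 2 * (1 + c ^+ 2))); last first.
    by rewrite ler_pM2r ?addr_gt0// ler_peMl// ltW.
  by rewrite -mulrA ltr_pM2l//; lra.
have cc : expR (- (x / 3)) @[x --> eps] --> expR (- (eps / 3)).
  apply: continuous_cvg; first exact: continuous_expR.
  by apply: cvgN; apply: cvgMr_tmp.
have cX n : expR (- (x / 3)) ^+ n @[x --> eps] --> expR (- (eps / 3)) ^+ n.
  exact: (cvg_comp _ _ cc (@exprn_continuous _ n _)).
have c1 : 1 - expR (- (x / 3)) ^+ 3 @[x --> eps] --> 1 - expR (- (eps / 3)) ^+ 3.
  by apply: cvgB; [exact: cvg_cst|exact: cX].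
have cont : staircase_variance (expR (- (x / 3))) @[x --> eps] -->
    staircase_variance (expR (- (eps / 3))).
  apply: cvgM.
    apply: cvgD => //; apply: cvgMr_tmp; apply: cvgM => //.
    by apply: cvgD => //; exact: cvg_cst.
  apply: cvgV.
    rewrite expf_neq0// gt_eqF// subr_gt0 exprn_ilt1 ?expR_ge0//.
    by rewrite expR_lt1 oppr_lt0 divr_gt0.
  exact: (cvg_comp _ _ c1 (@exprn_continuous _ 2 _)).
near eps^'- => x.
exists x; split.
  by apply/andP; split; near: x; [exact: nbhs_left_gt|exact: nbhs_left_lt].
near: x.
have := cvgr_le _ (cvg_at_left_filter cont) _ lt0.
by apply.
Unshelve. all: by end_near.
Qed.

End staircase.

(** * Interpolation at small nodes *)

Section decoding.
Context {R : realType}.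

(** All nodes scale with [s], so inverting one Vandermonde matrix serves every [s]. Their sign makes
    the constant coefficient of a monic polynomial with these roots nonnegative. *)
Definition node N (s : R) (j : 'I_N) : R := - (s * j.+1%:R).

Lemma cvg_sumr (T : Type) (F : set_system T) (I : Type) (r : seq I) (P : pred I)
    (f : I -> T -> R) (a : I -> R) : Filter F ->
  (forall i, P i -> f i x @[x --> F] --> a i) ->
  \sum_(i <- r | P i) f i x @[x --> F] --> \sum_(i <- r | P i) a i.
Proof. by move=> FF fa; apply: cvg_big => //; exact: add_continuous. Qed.

(* The Vandermonde system prescribes the values on ['X^m] for [m < N]; on higher
   powers the weights give a positive power of [s]. *)
Lemma node_weights N (c : nat -> R) :
  exists d : R -> 'I_N -> R, forall q : {poly R},
    \sum_j d s j * q.[node s j] @[s --> 0^'+] --> \sum_(m < N) c m * q`_m.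
Proof.
pose a : 'rV[R]_N := \row_j node 1 j.
pose V := invmx (Vandermonde N a).
have aE j : a 0 j = - j.+1%:R by rewrite mxE /node mul1r.
have unitV : Vandermonde N a \in unitmx.
  rewrite unitmxE unitfE det_Vandermonde; apply/prodf_neq0 => i _.
  apply/prodf_neq0 => j ij; rewrite !aE opprK addrC subr_eq0 eqr_nat eqSS.
  by rewrite neq_ltn ij.
have VK (m m' : 'I_N) : \sum_j V j m' * a 0 j ^+ m = (m == m')%:R.
  have /matrixP/(_ m m') := mulmxV unitV.
  rewrite !mxE => <-; apply: eq_bigr => j _; by rewrite !mxE mulrC.
(* [V] solves the system at scale 1; dividing by [s ^+ m] transfers the solution to scale [s]. On a
   power [m >= N] there remain factors [s ^+ (m - m')] with [m' < N]. *)
pose d (s : R) (j : 'I_N) := \sum_(m < N) c m / s ^+ m * V j m.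
have dE (s : R) m : s != 0 -> \sum_j d s j * node s j ^+ m =
    \sum_(m' < N) c m' * (s ^+ m / s ^+ m') * \sum_j V j m' * a 0 j ^+ m.
  move=> s0; under eq_bigr do rewrite mulr_suml.
  rewrite exchange_big; apply: eq_bigr => m' _; rewrite mulr_sumr.
  apply: eq_bigr => j _; rewrite aE /node -mulrN exprMn; ring.
exists d => q.
have dX m : \sum_j d s j * node s j ^+ m @[s --> 0^'+] --> (if (m < N)%N then c m else 0).
  have near0 : \forall s \near (0 : R)^'+, s != 0.
    by near do rewrite gt_eqF//; exact: nbhs_right_gt.
  case: ifPn => mN.
    have VKm (m' : 'I_N) : \sum_j V j m' * a 0 j ^+ m = (Ordinal mN == m')%:R.
      exact: (VK (Ordinal mN) m').
    apply: cvg_near_cst; near=> s.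
    have s0 : s != 0 by near: s.
    rewrite dE// (bigD1 (Ordinal mN))//= VKm eqxx mulfV ?expf_neq0// !mulr1.
    rewrite big1 ?addr0// => m' mm'; rewrite VKm eq_sym (negPf mm').
    by rewrite mulr0.
  rewrite -leqNgt in mN.
  apply: (@cvg_trans _ (\sum_(m' < N) c m' * s ^+ (m - m') *
      \sum_j V j m' * a 0 j ^+ m @[s --> 0^'+])).
    apply: near_eq_cvg; near=> s.
    have s0 : s != 0 by near: s.
    rewrite dE//; apply: eq_bigr => m' _; rewrite -expfB//.
    by rewrite (leq_trans (ltn_ord m')).
  have lim0 : \sum_(m' < N) c m' * 0 * (\sum_j V j m' * a 0 j ^+ m) = 0.
    by rewrite big1// => i _; rewrite mulr0 mul0r.
  suff : \sum_(m' < N) c m' * s ^+ (m - m') * (\sum_j V j m' * a 0 j ^+ m)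
      @[s --> 0^'+] --> \sum_(m' < N) c m' * 0 * (\sum_j V j m' * a 0 j ^+ m).
    by rewrite lim0.
  apply: cvg_sumr => m' _; apply: cvgMr_tmp; apply: cvgMl_tmp.
  apply: cvg_at_right_filter.
  have mm' : (0 < m - m')%N by rewrite subn_gt0 (leq_trans (ltn_ord m')).
  have := @exprn_continuous R (m - m') 0.
  by rewrite /continuous_at expr0n gtn_eqF.
apply: (@cvg_trans _ (\sum_(m < size q) q`_m * (\sum_j d s j * node s j ^+ m) @[s --> 0^'+])).
  apply: near_eq_cvg; near=> s.
  under eq_bigr do rewrite mulr_sumr; rewrite exchange_big; apply: eq_bigr => j _.
  by rewrite horner_coef mulr_sumr; apply: eq_bigr => i _; rewrite mulrCA.
have limE : \sum_(m < size q) q`_m * (if (m < N)%N then c m else 0) =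
    \sum_(m < N) c m * q`_m.
  pose f m := if (m < N)%N then c m * q`_m else 0.
  have widen k : (k <= maxn N (size q))%N ->
      (forall m, (k <= m)%N -> f m = 0) ->
      \sum_(m < k) f m = \sum_(m < maxn N (size q)) f m.
    move=> kK f0; rewrite (big_ord_widen _ f kK) big_mkcond.
    by apply: eq_bigr => m _; case: ltnP => // /f0 ->.
  transitivity (\sum_(m < size q) f m).
    by apply: eq_bigr => m _; rewrite /f mulrC; case: ifP; rewrite ?mul0r.
  rewrite widen ?leq_maxr//; last first.
    by move=> m qm; rewrite /f nth_default// mulr0 if_same.
  rewrite -(widen N) ?leq_maxl//; last by move=> m; rewrite /f ltnNge => ->.
  by apply: eq_bigr => m _; rewrite /f ltn_ord.
by rewrite -limE; apply: cvg_sumr => m _; apply: cvgMl_tmp; exact: dX.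
Unshelve. all: by end_near.
Qed.

End decoding.

(** * The limiting decoder and the shifts that hide an input *)

Section ideal_decoding.
Context {R : realType} (T : nat).
Implicit Types (M N : nat) (l : R).

(* [None] stands for the input, [Some 0] for the main noise and [Some k],
   [k > 0], for the [k]-th masking noise. *)
Definition letter (o : option 'I_T) : {poly R} :=
  if o is Some k then if k == 0 :> nat then 1 - 'X^T else 'X^k else 1.

(** In the limit each factor of the error is, up to the global sign, [1 - l] times the input minus
    [l] times the main noise. *)
Definition residual l (o : option 'I_T) : R := if o is Some _ then - l else 1 - l.

Lemma size_letter o : (0 < T)%N -> (size (letter o) <= T.+1)%N.
Proof.
move=> T0; case: o => [k|] /=; last by rewrite size_poly1.
case: eqP => _; last by rewrite size_polyXn ltnS ltnW.
by apply: leq_trans (size_polyD _ _) _; rewrite geq_max size_poly1 size_polyN size_polyXn /= leqnn.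
Qed.

(* The ideal functional is [q |-> q.[1] - (1-l)^M q.[theta]] with
   [theta^T = 1/(1-l)]; it kills ['X^(M*T)], hence only the coefficients of
   degree at most [(M-1)*T] matter. *)
Lemma ideal_coefficients M N l : (0 < T)%N -> (0 < M)%N ->
  ((M - 1) * T + 1 <= N)%N -> (N <= M * T)%N -> 0 < l < 1 ->
  exists c : nat -> R, forall f : {ffun 'I_M -> option 'I_T},
    (forall i k, f i = Some k -> k = 0%N :> nat) ->
    \sum_(m < N) c m * (\prod_i letter (f i))`_m - [forall i, f i == None]%:R =
    - \prod_i residual l (f i).
Proof.
move=> T0 M0 MN NM /andP[l0 l1].
pose a := 1 - l.
have a0 : 0 < a by rewrite subr_gt0.
pose theta := a `^ (- T%:R^-1).
have thetaT : theta ^+ T = a^-1.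
  rewrite -powR_mulrn ?powR_ge0// -powRrM mulNr mulVf ?pnatr_eq0 -?lt0n//.
  by rewrite powR_inv1 ?ltW.
pose c m := 1 - a ^+ M * theta ^+ m.
exists c => f f0.
pose E (q : {poly R}) := \sum_(m < N) c m * q`_m.
have EE (q : {poly R}) : (size q <= N)%N -> E q = q.[1] - a ^+ M * q.[theta].
  move=> sq; rewrite !(horner_coef_wide _ sq) mulr_sumr -sumrB.
  apply: eq_bigr => m _; rewrite /c expr1n mulr1; ring.
set p := \prod_i _; rewrite -/(E p).
(* If some letter is the input, the degree of [p] is at most [(M - 1) * T], hence below [N].
   Otherwise [p] is [(1 - 'X^T) ^+ M], and its top term [q] is split off: truncation below
   [N <= M * T] drops [q], and the ideal functional kills it. *)
have pE : E p = p.[1] - a ^+ M * p.[theta].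
  have [[i fi]|fS] := pselect (exists i, f i = None).
    apply: EE; apply: leq_trans MN; apply: leq_trans (size_prod_leq _ _) _.
    rewrite (bigD1 i)//= fi size_poly1 cardE -cardE card_ord.
    have : (\sum_(j < M | j != i) size (letter (f j)) <= \sum_(j < M | j != i) T.+1)%N.
      by apply: leq_sum => j _; exact: size_letter.
    rewrite sum_nat_const cardC1 card_ord mulnS subn1.
    move: (\sum_(j < M | j != i) _)%N (M.-1 * T)%N => S K.
    by rewrite leq_subLR addn1 addnS; case: (M) M0 => // m _ /=; rewrite addSn add1n !ltnS.
  have pX : p = (1 - 'X^T) ^+ M.
    rewrite /p -[X in _ ^+ X](card_ord M) -prodr_const; apply: eq_bigr => i _.
    case fi : (f i) => [k|]; last by case: fS; exists i.
    by rewrite /= (f0 _ _ fi).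
  pose q : {poly R} := (- 'X^T) ^+ M.
  have qX : q = (-1) ^+ M *: 'X^(T * M) by rewrite /q -scaleN1r exprZn -exprM.
  have Eq : E q = 0.
    rewrite /E big1// => m _; rewrite qX coefZ coefXn ltn_eqF ?mulr0//.
    by rewrite mulnC (leq_trans (ltn_ord m)).
  have Dq : q.[1] - a ^+ M * q.[theta] = 0.
    rewrite qX !hornerZ !hornerXn expr1n exprM thetaT exprVn mulrCA mulfV.
      by rewrite subrr.
    by rewrite expf_neq0// gt_eqF.
  have EB : E p = E (p - q) + E q.
    rewrite /E -big_split /=; apply: eq_bigr => m _.
    by rewrite coefB; ring.
  rewrite EB Eq addr0 EE; first by rewrite !hornerD !hornerN -[RHS]subr0 -Dq; ring.
  (* In the factorisation of a difference of [M]-th powers the first factor is 1, and the other is a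
     sum of products of [M - 1] polynomials of degree at most [T]. *)
  rewrite pX /q subrXX opprK addrNK mul1r (leq_trans _ MN)//.
  apply: leq_trans (size_sum _ _ _) _; apply/bigmax_leqP => i _.
  have sX : (size (1 - 'X^T : {poly R})%R <= T.+1)%N.
    apply: leq_trans (size_polyD _ _) _.
    by rewrite geq_max size_poly1 size_polyN size_polyXn /= leqnn.
  have sN : (size (- 'X^T : {poly R})%R <= T.+1)%N by rewrite size_polyN size_polyXn.
  have exp_leq (r : {poly R}) n : (size r <= T.+1)%N -> (size (r ^+ n)%R <= (T * n).+1)%N.
    move=> sr; apply: leq_trans (size_poly_exp_leq _ _) _.
    by rewrite ltnS leq_mul2r; apply/orP; right; case: (size r) sr.
  apply: leq_trans (size_polyMleq _ _) _.
  have := exp_leq _ (M.-1 - i)%N sX; have := exp_leq _ i sN.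
  have -> : (M - 1 = (M.-1 - i) + i)%N by rewrite subnK ?subn1// -ltnS prednK.
  rewrite mulnDl !(mulnC _ T).
  move: (size _) (size _) (T * _)%N (T * _)%N; lia.
have p1 : p.[1] = [forall i, f i == None]%:R.
  rewrite horner_prod; case: (boolP [forall i, _]) => [/forallP fN|].
    by rewrite big1// => i _; rewrite (eqP (fN i)) hornerE.
  rewrite negb_forall => /existsP[i]; case fi : (f i) => [k|]// _.
  by rewrite (bigD1 i)//= fi /= (f0 _ _ fi) eqxx !hornerE expr1n subrr mul0r.
have ptheta : a ^+ M * p.[theta] = \prod_i residual l (f i).
  rewrite horner_prod -[X in a ^+ X](card_ord M) -prodr_const -big_split /=.
  apply: eq_bigr => i _; case fi : (f i) => [k|] /=; last by rewrite hornerE mulr1.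
  rewrite (f0 _ _ fi) eqxx !hornerE thetaT /a; field.
  by rewrite gt_eqF.
by rewrite pE p1 ptheta addrAC subrr add0r.
Qed.

Definition share_weight (eta sig2 tau2 : R) (o : option 'I_T) : R :=
  if o is Some k then if k == 0 :> nat then sig2 else tau2 else eta.

(* The mean squared error when the [i]-th expansion variable labelled [o] has
   variance [w o]. *)
Definition decoding_error M N (d : 'I_N -> R) (s : R) (w : option 'I_T -> R) : R :=
  \sum_(f : {ffun 'I_M -> option 'I_T}) (\prod_i w (f i)) *
    (\sum_j d j * (\prod_i letter (f i)).[node s j] - [forall i, f i == None]%:R) ^+ 2.

(** The limit of the error as [s] tends to 0 is a polynomial [P] in [rho], and [P.[0]] meets the
    target. So [rho] is fixed first, using half-open slack [xi], and then every small [s] works. *)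
Lemma exists_decoder M N (eta v sig2 tau2 xi : R) : (0 < T)%N -> (0 < M)%N ->
  ((M - 1) * T + 1 <= N)%N -> (N <= M * T)%N -> 0 < eta -> 0 < v ->
  0 <= sig2 <= v -> 0 < xi ->
  exists (rho : R) (d : R -> 'I_N -> R), 0 < rho /\
    \forall s \near 0^'+, decoding_error M (d s) s
        (share_weight eta sig2 (rho ^+ 2 * tau2)) <=
      (eta * v / (eta + v)) ^+ M + xi.
Proof.
move=> T0 M0 MN NM eta0 v0 /andP[sig0 sigv] xi0.
have ev0 : 0 < eta + v by rewrite addr_gt0.
(* The minimiser of [eta * (1 - l) ^+ 2 + v * l ^+ 2], the linear estimation error; the minimum is
   [eta * v / (eta + v)]. *)
pose l := eta / (eta + v).
have l01 : 0 < l < 1.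
  by rewrite divr_gt0//= ltr_pdivrMr// mul1r ltrDl.
have [c cP] := ideal_coefficients T0 M0 MN NM l01.
have [d dP] := node_weights N c.
pose e (f : {ffun 'I_M -> option 'I_T}) : R :=
  \sum_(m < N) c m * (\prod_i letter (f i))`_m - [forall i, f i == None]%:R.
pose W (o : option 'I_T) : {poly R} :=
  if o is Some k then if k == 0 :> nat then sig2%:P else tau2 *: 'X^2 else eta%:P.
pose P : {poly R} := \sum_(f : {ffun 'I_M -> option 'I_T})
  (\prod_i W (f i)) * (e f ^+ 2)%:P.
have WE rho o : (W o).[rho] = share_weight eta sig2 (rho ^+ 2 * tau2) o.
  case: o => [k|]; rewrite /W /share_weight ?hornerC//.
  by case: ifP; rewrite ?hornerC// hornerZ hornerXn mulrC.
have PE rho : P.[rho] = \sum_(f : {ffun 'I_M -> option 'I_T})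
    (\prod_i share_weight eta sig2 (rho ^+ 2 * tau2) (f i)) * e f ^+ 2.
  rewrite /P horner_sum; apply: eq_bigr => f _.
  rewrite hornerM hornerC horner_prod; congr (_ * _).
  by apply: eq_bigr => i _; exact: WE.
have P0 : P.[0] <= (eta * v / (eta + v)) ^+ M.
  have -> : P.[0] = (eta * (1 - l) ^+ 2 + sig2 * l ^+ 2) ^+ M.
    rewrite PE expr0n mul0r.
    pose F o := share_weight eta sig2 0 o * residual l o ^+ 2.
    transitivity (\prod_(i < M) \sum_o F o).
      rewrite bigA_distr_bigA; apply: eq_bigr => f _.
      rewrite big_split /= prodrXl.
      (* Words without masking letters are covered by [ideal_coefficients]; the others have weight 0
         at [rho = 0]. *)
      have [f0|] := pselect (forall i k, f i = Some k -> k = 0%N :> nat).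
        by rewrite /e cP// sqrrN.
      move=> /existsNP[i /existsNP[k /not_implyP[fi k0]]].
      rewrite (bigD1 i)//= fi /share_weight; case: eqP => // _.
      by rewrite !mul0r.
    rewrite prodr_const card_ord; congr (_ ^+ _).
    rewrite (bigD1 None)//= (bigD1 (Some (Ordinal T0)))//= /F /= sqrrN.
    rewrite big1 ?addr0// => -[k|]//= k0; case: eqP => [k00|_]; last by rewrite mul0r.
    by case/negP: k0; apply/eqP; congr Some; exact: val_inj.
  apply: lerXn2r; rewrite ?nnegrE.
  - by rewrite addr_ge0// mulr_ge0 ?sqr_ge0// ltW.
  - by rewrite divr_ge0 ?mulr_ge0// ltW.
  apply: (@le_trans _ _ (eta * (1 - l) ^+ 2 + v * l ^+ 2)).
    by rewrite lerD2l ler_wpM2r ?sqr_ge0.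
  rewrite le_eqVlt; apply/orP; left; apply/eqP; rewrite /l; field.
  by rewrite gt_eqF.
have [rho [rho0 Prho]] : exists rho, 0 < rho /\ P.[rho] < (eta * v / (eta + v)) ^+ M + xi.
  near (0 : R)^'+ => rho.
  exists rho; split; first by near: rho; exact: nbhs_right_gt.
  near: rho.
  apply: (cvgr_lt P.[0] (cvg_at_right_filter (@continuous_horner _ P 0))).
  by rewrite (le_lt_trans P0)// ltrDl.
exists rho, d; split => //.
apply: (cvgr_le P.[rho]) => //.
rewrite PE; apply: cvg_sumr => f _; apply: cvgMl_tmp.
have ce : \sum_j d s j * (\prod_i letter (f i)).[node s j] -
    [forall i, f i == None]%:R @[s --> 0^'+] --> e f.
  by apply: cvgB; [exact: dP|exact: cvg_cst].
exact: (cvg_comp _ _ ce (@exprn_continuous _ 2 _)).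
Unshelve. all: by end_near.
Qed.

Definition share_coef (rho y : R) (k : 'I_T) : R :=
  (if k == 0 :> nat then 1 else rho) * (letter (Some k)).[y].

(** The coefficient is a polynomial in [s], read off a bivariate product, and it vanishes at
    [s = 0], where the product becomes ['X^T] and [k < T]. *)
Lemma small_node_coefs N (rho : R) (t : 'I_T -> 'I_N) (k : nat) : (k < T)%N -> 0 < rho ->
  \forall s \near 0^'+, `|(\prod_(j < T) ('X - (node s (t j))%:P))`_k| <= rho.
Proof.
move=> kT rho0.
pose B : {poly {poly R}} := \prod_(j < T) ('X - (- ((t j).+1%:R) *: 'X)%:P).
have BE s : (\prod_(j < T) ('X - (node s (t j))%:P))`_k = (B`_k).[s].
  rewrite -[RHS]/(horner_eval s B`_k) -coef_map /B rmorph_prod /=.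
  apply: (congr1 (fun p : {poly R} => p`_k)); apply: eq_bigr => j _.
  rewrite rmorphB /= map_polyX map_polyC /= /horner_eval hornerZ hornerX.
  by rewrite /node mulNr mulrC.
have B0 : (B`_k).[0] = 0.
  have BX : \prod_(j < T) ('X - (node 0 (t j))%:P) = 'X^T :> {poly R}.
    transitivity (\prod_(j < T) ('X : {poly R})); last by rewrite prodr_const card_ord.
    by apply: eq_bigr => j _; rewrite /node mul0r oppr0 subr0.
  rewrite -BE BX.
  by rewrite coefXn ltn_eqF.
have cvB : `|(B`_k).[s]| @[s --> 0^'+] --> `|(B`_k).[0]|.
  by apply: cvg_norm; exact: (cvg_at_right_filter (@continuous_horner _ _ 0)).
have := cvgr_le _ cvB rho; rewrite B0 normr0 => /(_ _ rho0).
by apply: filterS => s; rewrite BE.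
Qed.

(* If [Q] is the monic polynomial of degree [T] vanishing at the chosen nodes,
   the shift is read off [1 - Q / (1 + Q.[0])], which has value 1 there and
   the right shape; negative nodes make [Q.[0]] nonnegative. *)
Lemma exists_hiding_shift N (rho : R) : (0 < T)%N -> 0 < rho ->
  \forall s \near 0^'+, forall t : 'I_T -> 'I_N,
    exists z : 'I_T -> R, (forall k, `|z k| <= 1) /\
      forall j, \sum_k z k * share_coef rho (node s (t j)) k = 1.
Proof.
move=> T0 rho0.
near=> s => t.
have s0 : 0 < s by near: s; exact: nbhs_right_gt.
pose Q : {poly R} := \prod_(j < T) ('X - (node s (t j))%:P).
have Qsmall (k : 'I_T) : `|Q`_k| <= rho.
  (* Encoding the choice of nodes as a finite function makes it range over a finite type, so one [s]
     can serve all choices at once. *)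
  have small : forall t (k : 'I_T),
      `|(\prod_(j < T) ('X - (node s ((t : {ffun 'I_T -> 'I_N}) j))%:P))`_k| <= rho.
    near: s; apply: filter_forall => t'; apply: filter_forall => k'.
    exact: small_node_coefs.
  have := small [ffun j => t j] k.
  by under eq_bigr do rewrite ffunE.
have q0 : 0 <= Q`_0.
  rewrite -horner_coef0 horner_prod; apply: prodr_ge0 => j _.
  by rewrite !hornerE opprK mulr_ge0// ltW.
have q1 : 0 < 1 + Q`_0 by rewrite ltr_wpDr.
exists (fun k => if k == 0 :> nat then (1 + Q`_0)^-1 else - (Q`_k / rho) / (1 + Q`_0)).
split=> [k|j].
  case: ifP => _.
    by rewrite ger0_norm ?invr_ge0 ?(ltW q1)// invf_le1// lerDl.
  rewrite normrM normrN normfV (ger0_norm (ltW q1)) ler_pdivrMr// mul1r.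
  apply: (@le_trans _ _ 1); last by rewrite lerDl.
  by rewrite normrM normfV (gtr0_norm rho0) ler_pdivrMr// mul1r.
pose y := node s (t j); rewrite -/y.
have Qy : Q.[y] = 0.
  by rewrite horner_prod (bigD1 j)//= !hornerE subrr mul0r.
have sQ : size Q = T.+1.
  by rewrite size_prod_XsubC /index_enum -enumT size_enum_ord.
have QT : Q`_T = 1.
  have /monicP := monic_prod_XsubC (index_enum 'I_T) xpredT (fun j => node s (t j)).
  by rewrite lead_coefE -/Q sQ.
have QE : Q.[y] = \sum_(k < T) Q`_k * y ^+ k + y ^+ T.
  by rewrite horner_coef sQ big_ord_recr /= QT mul1r.
apply: (mulfI (lt0r_neq0 q1)); rewrite mulr1 mulr_sumr.
(* [Q]_0[is added and subtracted at]k = 0[to make the full sum of the]Q[_k * y ^+ k] appear; since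
   [Q] is monic and vanishes at [y], that sum is [- y ^+ T]. *)
have shift_eq (k : 'I_T) : (1 + Q`_0) * ((if k == 0 :> nat then (1 + Q`_0)^-1 else
    - (Q`_k / rho) / (1 + Q`_0)) * share_coef rho y k) =
    (k == 0 :> nat)%:R * (1 - y ^+ T + Q`_0) - Q`_k * y ^+ k.
  rewrite /share_coef /letter; case: eqP => [k0|k0]; rewrite !hornerE.
    by rewrite k0 expr0 /=; field; rewrite gt_eqF.
  by rewrite /=; field; rewrite !gt_eqF.
under eq_bigr do rewrite shift_eq.
rewrite big_split /= sumrN.
have -> : \sum_(k < T) Q`_k * y ^+ k = - y ^+ T.
  by apply/eqP; rewrite -addr_eq0 -QE Qy.
rewrite (bigD1 (Ordinal T0))//= big1; first by rewrite mul1r; ring.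
by move=> k; rewrite -val_eqE /= => /negPf ->; rewrite mul0r.
Unshelve. all: by end_near.
Qed.

End ideal_decoding.

(** * The coding scheme *)

(** It suffices to treat open sets, and each of these is a countable union of boxes with rational
    centres, whose preimages are finite intersections of coordinate events. *)
Lemma measurable_row_preimage (R : realType) d (Om : measurableType d) n
    (V : 'I_n -> Om -> R) (B : set 'rV[R]_n) : (forall k, measurable_fun setT (V k)) ->
  borel_Rn B -> measurable [set w | B (\row_k V k w)].
Proof.
move=> mV; move: B; apply: smallest_sub.
  split=> [|A mA|A mA].
  - by rewrite [X in measurable X](_ : _ = set0)//; apply/seteqP; split.
  - have -> : [set w | (setT `\` A) (\row_k V k w)] = ~` [set w | A (\row_k V k w)].
      by apply/seteqP; split=> w /=; [case|].
    exact: measurableC.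
  - have -> : [set w | (\bigcup_k A k) (\row_k V k w)] =
        \bigcup_k [set w | A k (\row_k V k w)] by [].
    exact: bigcupT_measurable.
move=> U /= openU.
pose box (p : {ffun 'I_n -> rat} * nat) : set 'rV[R]_n :=
  [set x | forall k, `|x 0 k - ratr (p.1 k)| < p.2.+1%:R^-1].
pose F (i : nat) : set Om :=
  if unpickle i is Some p then
    if `[< box p `<=` U >] then [set w | box p (\row_k V k w)] else set0
  else set0.
have -> : [set w | U (\row_k V k w)] = \bigcup_i F i.
  apply/seteqP; split=> [w /= Uw|w [i _]]; last first.
    by rewrite /F; case: unpickle => [p|//]; case: asboolP => // pU /pU.
  have /nbhs_ballP[e /= e0 eU] := open_nbhs_nbhs (conj openU Uw).
  (* The factor 2 comes from the triangle inequality through the rational centre of the box. *)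
  have [m me] : exists m, 2 * m.+1%:R^-1 < e :> R.
    have [m] := ltr_add_invr (divr_gt0 e0 (ltr0n R 2)).
    by rewrite add0r ltr_pdivlMr// mulrC => ?; exists m.
  pose r := m.+1%:R^-1 : R.
  have r0 : 0 < r by rewrite invr_gt0.
  have near_rat (k : 'I_n) : exists q : rat, `|V k w - ratr q| < r.
    have /rat_in_itvoo[q] : V k w - r < V k w + r by rewrite ltrD2l gtrN.
    rewrite in_itv /= => qr; exists q.
    by rewrite distrC ltr_distl.
  have [q qV] := choice near_rat.
  exists (pickle ([ffun k => q k], m)) => //.
  rewrite /F pickleK asboolT; first by move=> k /=; rewrite mxE ffunE; exact: qV.
  move=> x xq; apply: eU; rewrite /ball /= /mx_ball; split => // i k.
  rewrite (ord1 i) mxE /ball /=.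
  have := xq k; rewrite /= ffunE => xk.
  rewrite -(subrKA (ratr (q k))) (le_lt_trans (ler_normD _ _))//.
  apply: lt_trans me; rewrite mulr_natl mulr2n ltrD ?qV//.
  by rewrite distrC.
apply: bigcupT_measurable => i; rewrite /F; case: unpickle => [p|//].
case: asboolP => // _.
have -> : [set w | box p (\row_k V k w)] =
    \bigcap_(k in [set: 'I_n]) (V k @^-1` ball (ratr (p.1 k) : R) p.2.+1%:R^-1).
  apply/seteqP; split=> w /=.
    by move=> wp k _; have := wp k; rewrite /ball /= mxE distrC.
  by move=> wp k; have := wp k I; rewrite /ball /= mxE distrC.
apply: fin_bigcap_measurable => [|k _]; first exact: finite_finset.
rewrite -[X in measurable X]setTI; apply: mV => //.
exact: measurable_ball.
Qed.

Lemma exists_noise_family (R : realType) T (mu : 'I_T -> probability (measurableTypeR R) R)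
    (var eps : 'I_T -> R) :
  (forall k (r : R) (S : set R), `|r| <= 1 -> measurable S ->
    (mu k ((fun x => (x + r)%R) @^-1` S) <= (expR (eps k))%:E * mu k S)%E) ->
  (forall k, (mu k).-integrable setT (fun x => (x : R)%:E)) ->
  (forall k, \int[mu k]_x (x : R)%:E = 0)%E ->
  (forall k, (mu k).-integrable setT (fun x => ((x : R) ^+ 2)%:E)) ->
  (forall k, \int[mu k]_x ((x : R) ^+ 2)%:E = (var k)%:E)%E ->
  exists d (Om : measurableType d) (P : probability Om R) (X : 'I_T -> Om -> R),
  [/\ forall k, measurable_fun setT (X k),
    forall k, P.-integrable setT (fun w => (X k w)%:E) /\ (\int[P]_w (X k w)%:E = 0)%E,
    forall k k', P.-integrable setT (fun w => (X k w * X k' w)%:E) /\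
      (\int[P]_w (X k w * X k' w)%:E = ((k == k')%:R * var k)%:E)%E &
    forall z : 'I_T -> R, (forall k, `|z k| <= 1) ->
      exists t : Om -> Om, [/\ measurable_fun setT t,
        forall k w, X k (t w) = X k w + z k &
        forall S, measurable S -> (P (t @^-1` S) <= (expR (\sum_k eps k))%:E * P S)%E]].
Proof.
move=> muDP int1 mean0 int2 moment2.
have [d [Om [P [X [mX intX shiftX]]]]] := exists_product_space mu.
exists d, Om, P, X.
have intn k m : (m <= 2)%N -> (mu k).-integrable setT (EFin \o (fun x : R => x ^+ m)).
  case: m => [|[|[|//]]] _; [|exact: int1|exact: int2].
  exact: finite_measure_integrable_cst.
split.
- by move=> k; exact: mX.
- move=> k; have [intk intkE] := integral_coordinate intX (int1 k).
  by split=> //; rewrite -[RHS](mean0 k) -intkE.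
- move=> k k'.
  (* The exponents are 0, 1 or 2, so a single product formula yields both variances and
     covariances. *)
  pose f i (x : R) := x ^+ ((i == k) + (i == k')).
  have fint i : (mu i).-integrable setT (EFin \o f i).
    by apply: intn; case: (i == k); case: (i == k').
  have [fi fE] := intX f fint.
  have fX w : \prod_i f i (X i w) = X k w * X k' w.
    under eq_bigr do rewrite /f exprD.
    rewrite big_split /= (bigD1 k)//= eqxx big1 ?mulr1; last first.
      by move=> i /negPf ->; rewrite expr0.
    rewrite (bigD1 k')//= eqxx big1 ?mulr1 ?expr1//.
    by move=> i /negPf ->; rewrite expr0.
  have fXE : (fun w => (\prod_i f i (X i w))%:E) = (fun w => (X k w * X k' w)%:E).
    by apply/funext => w; rewrite fX.
  split; first by rewrite -fXE.
  rewrite -fXE fE (bigD1 k)//= /f eqxx.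
  have [<-|kk'] := eqVneq k k'.
    rewrite mul1r big1 ?mule1; first exact: moment2.
    move=> i /negPf ->; under eq_integral do rewrite expr0.
    by rewrite integral_cst//= mul1e probability_setT.
  rewrite mul0r; under eq_integral do rewrite expr1.
  by rewrite mean0 mul0e.
- move=> z z1.
  have [//||k S mS|t [mt Xt Pt]] := shiftX (fun k x => x + z k) (expR \o eps).
  + by move=> k; exact: measurable_funD.
  + by move=> k; exact: expR_ge0.
  + exact: muDP.
  exists t; split=> // S mS; rewrite expR_sum.
  exact: Pt.
Qed.

(** * Validity, privacy and error of the scheme *)

Section scheme.
Context {R : realType} (T M N : nat).
Variables (rho s : R).
Context d1 (Om1 : measurableType d1) (P1 : probability Om1 R) (X : 'I_T -> Om1 -> R).
Variable var : 'I_T -> R.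
Hypothesis mX : forall k, measurable_fun setT (X k).
Hypothesis intX : forall k,
  P1.-integrable setT (fun w => (X k w)%:E) /\ (\int[P1]_w (X k w)%:E = 0)%E.
Hypothesis covX : forall k k', P1.-integrable setT (fun w => (X k w * X k' w)%:E) /\
  (\int[P1]_w (X k w * X k' w)%:E = ((k == k')%:R * var k)%:E)%E.
Hypothesis var_ge0 : forall k, 0 <= var k.
Context d (Om : measurableType d) (P : probability Om R) (Y : 'I_M -> Om -> Om1).
Hypothesis mY : forall i, measurable_fun setT (Y i).
Hypothesis integral_prodY : forall f : 'I_M -> Om1 -> R,
  (forall i, P1.-integrable setT (EFin \o f i)) ->
  P.-integrable setT (fun w => (\prod_i f i (Y i w))%:E) /\
  (\int[P]_w (\prod_i f i (Y i w))%:E = \prod_(i < M) \int[P1]_x (f i x)%:E)%E.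

Definition scale (k : 'I_T) : R := if k == 0 :> nat then 1 else rho.

Definition share_noise (j : 'I_N) (x : Om1) : R :=
  \sum_k share_coef rho (node s j) k * X k x.

Definition scheme_noise (i : 'I_M) (j : 'I_N) (w : Om) : R := share_noise j (Y i w).

Lemma measurable_share_noise j : measurable_fun setT (share_noise j).
Proof.
by apply: measurable_sum => k; apply: measurable_funM.
Qed.

Lemma integral_share_noise j :
  P1.-integrable setT (fun x => (share_noise j x)%:E) /\
  (\int[P1]_x (share_noise j x)%:E = 0)%E.
Proof.
have intk k : P1.-integrable setT (fun x => (share_coef rho (node s j) k * X k x)%:E).
  under eq_fun do rewrite EFinM.
  by apply: integrableZl => //; exact: (intX k).1.
have sE : (fun x => (share_noise j x)%:E) =
    (fun x => \sum_k (share_coef rho (node s j) k * X k x)%:E)%E.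
  by apply/funext => x; rewrite sumEFin.
split; rewrite sE; first exact: integrable_sum.
rewrite integral_sum// big1// => k _.
under eq_integral do rewrite EFinM.
by rewrite integralZl ?(intX k).2 ?mule0//; exact: (intX k).1.
Qed.

Lemma scheme_noise_valid : valid_noise P scheme_noise.
Proof.
split; [|split].
- by move=> i j; exact: measurableT_comp (measurable_share_noise j) (mY i).
- move=> i j; have [int0 int0E] := integral_share_noise j.
  have [inti intiE] := integral_coordinate integral_prodY (i := i) int0.
  split; first exact/Lfun1_integrable.
  by rewrite unlock intiE.
- move=> E EY.
  (* Every event generated by the noises of input [i] is a preimage under the coordinate [Y i],
     which reduces independence of the families to that of coordinates. *)
  have /choice[C CP] : forall i, exists C, measurable C /\ E i = Y i @^-1` C.
    move=> i; move: (E i) (EY i); apply: smallest_sub.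
      split.
      + by exists set0; split=> //; rewrite preimage_set0.
      + by move=> A [C [mC ->]]; exists (~` C); split; [exact: measurableC|rewrite setTD].
      + move=> A /choice[C CA]; exists (\bigcup_k C k); split.
          by apply: bigcupT_measurable => k; exact: (CA k).1.
        by rewrite preimage_bigcup; apply: eq_bigcup => // k _; exact: (CA k).2.
    move=> A [j [B [mB ->]]]; exists (share_noise j @^-1` B); split=> //.
    by rewrite -[X in measurable X]setTI; exact: measurable_share_noise.
  have EC : E = fun i => Y i @^-1` C i by apply/funext => i; exact: (CP i).2.
  have mC i : measurable (C i) by exact: (CP i).1.
  rewrite EC; apply: (probability_coordinates integral_prodY) => // i.
  by rewrite -[X in measurable X]setTI; exact: mY.
Qed.

(** Translating the noises of input [i] by [(a0 - a1) * z], and leaving the other inputs alone,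
    turns the observed row for [a1] into the one for [a0]. Each translation is at most 1 in size, so
    the price is [expR eps]. *)
Lemma scheme_noise_DP (eps : R) :
  (forall z : 'I_T -> R, (forall k, `|z k| <= 1) ->
    exists t : Om1 -> Om1, [/\ measurable_fun setT t,
      forall k w, X k (t w) = X k w + z k &
      forall S, measurable S -> (P1 (t @^-1` S) <= (expR eps)%:E * P1 S)%E]) ->
  (forall (u : 'I_M -> Om1 -> Om1) (a : 'I_M -> R),
    (forall i, measurable_fun setT (u i)) -> (forall i, 0 <= a i) ->
    (forall i S, measurable S -> (P1 (u i @^-1` S) <= (a i)%:E * P1 S)%E) ->
    exists t : Om -> Om, [/\ measurable_fun setT t,
      forall i w, Y i (t w) = u i (Y i w) &
      forall S, measurable S -> (P (t @^-1` S) <= (\prod_i a i)%:E * P S)%E]) ->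
  (forall t : 'I_T -> 'I_N, exists z : 'I_T -> R, (forall k, `|z k| <= 1) /\
    forall j, \sum_k z k * share_coef rho (node s (t j)) k = 1) ->
  T_node_DP P T scheme_noise eps.
Proof.
move=> shiftX shiftY hiding i a0 a1 a01 t _ B borelB.
have [z [z1 zt]] := hiding t.
have [k|u [mu Xu Pu]] := shiftX (fun k => (a0 - a1) * z k).
  by rewrite normrM mulr_ile1.
have [i'|i'|i' S mS|v [mv Yv Pv]] := shiftY (fun i' => if i' == i then u else id)
    (fun i' => if i' == i then expR eps else 1).
- by case: eqP => // _; exact: measurable_id.
- by case: eqP => // _; exact: expR_ge0.
- by case: eqP => _; [exact: Pu|rewrite mul1e].
have mS : measurable [set w | B (\row_k (a1 + scheme_noise i (t k) w))].
  apply: measurable_row_preimage => // k; apply: measurable_funD => //.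
  exact: measurableT_comp (measurable_share_noise _) (mY i).
have := Pv _ mS.
rewrite (bigD1 i)//= eqxx big1 ?mulr1; last by move=> i' /negPf ->.
congr (P _ <= _)%E; apply/seteqP.
have rowE w : \row_k (a1 + scheme_noise i (t k) (v w)) =
    \row_k (a0 + scheme_noise i (t k) w).
  apply/rowP => j; rewrite !mxE /scheme_noise Yv eqxx /share_noise.
  under eq_bigr do rewrite Xu mulrDr.
  rewrite big_split /=.
  have -> : \sum_k share_coef rho (node s (t j)) k * ((a0 - a1) * z k) = a0 - a1.
    rewrite -[RHS]mulr1 -(zt j) mulr_sumr; apply: eq_bigr => k _; ring.
  ring.
by split=> w /=; rewrite rowE.
Qed.

Definition noise_weight (v0 : R) (o : option 'I_T) : R :=
  if o is Some k then scale k ^+ 2 * var k else v0.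

Definition decoding_residual (dc : 'I_N -> R) (f : {ffun 'I_M -> option 'I_T}) : R :=
  \sum_j dc j * (\prod_i letter (f i)).[node s j] - [forall i, f i == None]%:R.

Definition share_term (a : 'I_M -> R) (i : 'I_M) (o : option 'I_T) (x : Om1) : R :=
  if o is Some k then scale k * X k x else a i.

(** Every share is a sum over letters, so the product over inputs is a sum over words [f]. The exact
    product of the inputs is the single word with all letters [None]. *)
Lemma error_expansion (dc : 'I_N -> R) (a : 'I_M -> R) w :
  \sum_j dc j * \prod_i (a i + scheme_noise i j w) - \prod_i a i =
  \sum_(f : {ffun 'I_M -> option 'I_T})
    decoding_residual dc f * \prod_i share_term a i (f i) (Y i w).
Proof.
have shareE i j : a i + scheme_noise i j w =
    \sum_o share_term a i o (Y i w) * (letter o).[node s j].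
  rewrite (bigD1 None)//= hornerC mulr1; congr (_ + _).
  rewrite (reindex_omap Some id) => [|[]//] /=.
  apply: eq_big => [k|k _]; first by rewrite eqxx.
  by rewrite /share_coef /scale; ring.
have -> : \sum_j dc j * \prod_i (a i + scheme_noise i j w) =
    \sum_j \sum_(f : {ffun 'I_M -> option 'I_T}) dc j *
      \prod_i (share_term a i (f i) (Y i w) * (letter (f i)).[node s j]).
  apply: eq_bigr => j _; rewrite -mulr_sumr; congr (_ * _).
  rewrite -(bigA_distr_bigA (fun i o => share_term a i o (Y i w) * (letter o).[node s j])).
  by apply: eq_bigr => i _; rewrite shareE.
rewrite exchange_big /=.
have -> : \prod_i a i = \sum_(f : {ffun 'I_M -> option 'I_T})
    [forall i, f i == None]%:R * \prod_i share_term a i (f i) (Y i w).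
  rewrite (bigD1 [ffun=> None])//= [X in _ + X]big1 ?addr0.
    rewrite (_ : [forall i, _]); last by apply/forallP => i; rewrite ffunE.
    by rewrite mul1r; apply: eq_bigr => i _; rewrite ffunE.
  move=> f fN; case: forallP => [fN'|]; last by rewrite mul0r.
  by case/eqP: fN; apply/ffunP => i; rewrite ffunE; apply/eqP.
rewrite -sumrB; apply: eq_bigr => f _; rewrite mulrBl mulr_suml; congr (_ - _).
apply: eq_bigr => j _; rewrite horner_prod big_split /=; ring.
Qed.

(** With the inputs frozen at [a], the terms of one share are orthogonal: a constant and centred,
    pairwise uncorrelated noises. *)
Lemma noise_mse (dc : 'I_N -> R) (a : 'I_M -> R) :
  (\int[P]_w ((\sum_j dc j * \prod_i (a i + scheme_noise i j w) - \prod_i a i) ^+ 2)%:E =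
   (\sum_(f : {ffun 'I_M -> option 'I_T})
     (\prod_i noise_weight (a i ^+ 2) (f i)) * decoding_residual dc f ^+ 2)%:E)%E.
Proof.
under eq_integral do rewrite error_expansion.
apply: (integral_sqr_tensor integral_prodY (phi := share_term a)
  (v := fun i => noise_weight (a i ^+ 2))) => i o o'.
- case: o o' => [k|] [k'|] /=.
  + under eq_fun do rewrite mulrACA EFinM.
    by apply: integrableZl => //; exact: (covX k k').1.
  + under eq_fun do rewrite mulrAC EFinM.
    by apply: integrableZl => //; exact: (intX k).1.
  + under eq_fun do rewrite mulrA EFinM.
    by apply: integrableZl => //; exact: (intX k').1.
  + exact: finite_measure_integrable_cst.
- case: o o' => [k|] [k'|] /=.
  + under eq_integral do rewrite mulrACA EFinM.
    rewrite integralZl//; last exact: (covX k k').1.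
    rewrite (covX k k').2 -EFinM; congr _%:E.
    rewrite (inj_eq Some_inj); case: eqVneq => [<-|_]; last by rewrite !mul0r mulr0.
    by rewrite !mul1r expr2.
  + under eq_integral do rewrite mulrAC EFinM.
    rewrite integralZl//; last exact: (intX k).1.
    by rewrite (intX k).2 mule0 mul0r.
  + under eq_integral do rewrite mulrA EFinM.
    rewrite integralZl//; last exact: (intX k').1.
    by rewrite (intX k').2 mule0 mul0r.
  + by rewrite integral_cst//= probability_setT mule1 mul1r expr2.
Qed.

(** Integrating the noise first leaves a polynomial in the squares of the inputs with nonnegative
    coefficients. Independence factors each monomial, and each second moment is at most [eta]. *)
Lemma scheme_mse_le (dc : 'I_N -> R) (eta : R) dA (OmA : measurableType dA)
    (PA : probability OmA R) (A : 'I_M -> OmA -> R) : valid_inputs PA A eta ->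
  (mse PA P A scheme_noise dc <= (\sum_(f : {ffun 'I_M -> option 'I_T})
     (\prod_i noise_weight eta (f i)) * decoding_residual dc f ^+ 2)%:E)%E.
Proof.
move=> [mA [momA indA]].
have A2 i : (\int[PA]_w (A i w ^+ 2)%:E <= eta%:E)%E.
  have [AL [A0 AV]] := momA i.
  move: AV; rewrite varianceE// A0 expe2 mule0 sube0; apply: le_trans.
  by rewrite unlock.
rewrite /mse.
pose F (w : OmA * Om) : \bar R :=
  ((\sum_(j < N) dc j * \prod_(i < M) (A i w.1 + scheme_noise i j w.2) -
    \prod_(i < M) A i w.1) ^+ 2)%:E.
have mF : measurable_fun setT F.
  apply/measurable_EFinP; apply: measurable_funX; apply: measurable_funB.
    apply: measurable_sum => j; apply: measurable_funM => //.
    apply: measurable_prod => i _; apply: measurable_funD.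
      exact: measurableT_comp (mA i) measurable_fst.
    apply: measurableT_comp measurable_snd.
    exact: measurableT_comp (measurable_share_noise j) (mY i).
  apply: measurable_prod => i _.
  exact: measurableT_comp (mA i) measurable_fst.
have F0 w : (0 <= F w)%E by rewrite lee_fin sqr_ge0.
rewrite (fubini_tonelli1 F)// /fubini_F /F /=.
under eq_integral do rewrite (noise_mse dc (fun i => A i _)).
pose h o (x : R) := noise_weight (x ^+ 2) o.
have h0 o x : 0 <= h o x.
  by rewrite /h; case: o => [k|] /=; rewrite ?sqr_ge0// mulr_ge0 ?sqr_ge0.
have mh o : measurable_fun setT (h o).
  rewrite /h; case: o => [k|] /=; first exact: measurable_cst.
  exact: measurable_funX.
have mhA o i : measurable_fun setT (fun w => h o (A i w)).
  exact: measurableT_comp (mh o) (mA i).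
under eq_integral do rewrite -sumEFin.
have term (f : {ffun 'I_M -> option 'I_T}) w :
    ((\prod_i noise_weight (A i w ^+ 2) (f i)) * decoding_residual dc f ^+ 2)%:E =
    ((decoding_residual dc f ^+ 2)%:E * (\prod_i h (f i) (A i w))%:E)%E.
  by rewrite mulrC EFinM.
rewrite ge0_integral_sum//; last 2 first.
- move=> f; apply/measurable_EFinP; apply: measurable_funM => //.
  by apply: measurable_prod => i _; exact: mhA.
- by move=> f w _; rewrite lee_fin mulr_ge0 ?sqr_ge0 ?prodr_ge0// => i _; exact: h0.
rewrite -sumEFin; apply: lee_sum => f _.
under eq_integral do rewrite term.
rewrite ge0_integralZl//; last 3 first.
- by apply/measurable_EFinP; apply: measurable_prod => i _; exact: mhA.
- by move=> w _; rewrite lee_fin prodr_ge0// => i _; exact: h0.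
- by rewrite lee_fin sqr_ge0.
rewrite (ge0_integral_prod_indep (h := fun i => h (f i)))//.
rewrite [X in (_ <= X%:E)%E]mulrC (EFinM (_ ^+ 2)); apply: lee_wpmul2l.
  by rewrite lee_fin sqr_ge0.
rewrite -prodEFin.
(* Nonnegativity is carried along because multiplying inequalities requires it. *)
have : (0 <= \prod_(i < M) \int[PA]_w (h (f i) (A i w))%:E <=
    \prod_(i < M) (noise_weight eta (f i))%:E)%E.
  apply: (big_ind2 (fun x y => 0 <= x <= y)%E); first by rewrite lee_fin ler01 lexx.
    by move=> x y x' y' /andP[? ?] /andP[? ?]; rewrite mule_ge0// lee_pmul.
  move=> i _; apply/andP; split.
    by apply: integral_ge0 => w _; rewrite lee_fin; exact: h0.
  rewrite /h; case: (f i) => [k|] /=; last exact: A2.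
  by rewrite integral_cst//= probability_setT mule1.
by case/andP.
Qed.

End scheme.

(** * Choice of the parameters *)

Lemma sigma_star2_gt0 (R : realType) (eps : R) : 0 < eps -> 0 < sigma_star2 eps.
Proof.
move=> eps0; rewrite /sigma_star2 divr_gt0//.
  by rewrite addr_gt0 ?expR_gt0// !mulr_gt0 ?powR_gt0 ?addr_gt0 ?expR_gt0.
by rewrite exprn_gt0// subr_gt0 expR_lt1 oppr_lt0.
Qed.

Theorem theorem1 (R : realType) (N T M : nat) (eta : R) :
  (0 < N)%N -> (0 < T)%N -> (0 < M)%N ->
  ((M - 1) * T + 1 <= N)%N -> (N <= M * T)%N -> 0 < eta ->
  forall eps xi : R, 0 < eps -> 0 < xi ->
  exists (d : measure_display) (Om : measurableType d)
    (P : probability Om R) (Rn : 'I_M -> 'I_N -> Om -> R) (dc : 'I_N -> R),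
    valid_noise P Rn /\ T_node_DP P T Rn eps /\
    (LMSE P Rn dc eta <=
       (eta ^+ M / (1 + SNR_star eta eps) ^+ M + xi)%:E)%E.
Proof.
move=> N0 T0 M0 MN NM eta0 eps xi eps0 xi0.
have v0 := sigma_star2_gt0 eps0; set v := sigma_star2 eps in v0.
have [eps1 [/andP[eps10 eps1lt] vareps1]] := staircase_variance_lt eps0.
(* The budget left over by the main noise, cut into [T] equal pieces: the [T - 1] masking noises
   together cost at most [eps - eps1]. *)
pose eps2 := (eps - eps1) / T%:R.
have T0' : 0 < T%:R :> R by rewrite ltr0n.
have eps20 : 0 < eps2 by rewrite divr_gt0// subr_gt0.
have [P1 [dp1 int11 mean1 int21 var1]] := exists_dp_noise eps10.
have [P2 [dp2 int12 mean2 int22 var2]] := exists_dp_noise eps20.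
pose mom (P : probability (measurableTypeR R) R) := fine (\int[P]_x ((x : R) ^+ 2)%:E).
have mom0 P : 0 <= mom P.
  by rewrite fine_ge0// integral_ge0// => x _; rewrite lee_fin sqr_ge0.
pose mu (k : 'I_T) := if k == 0 :> nat then P1 else P2.
pose var (k : 'I_T) := if k == 0 :> nat then mom P1 else mom P2.
pose eps_ (k : 'I_T) := if k == 0 :> nat then eps1 else eps2.
have momv : 0 <= mom P1 <= v.
  rewrite mom0 /= -lee_fin fineK ?integrable_fin_num//.
  by rewrite (le_trans var1)// lee_fin.
have epsle : \sum_k eps_ k <= eps.
  apply: (@le_trans _ _ (eps1 + \sum_(k < T) eps2)).
    rewrite (bigD1 (Ordinal T0))//= [in leRHS](bigD1 (Ordinal T0))//=.
    rewrite lerD// ler_wpDl// ?(ltW eps20)//.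
    by apply: ler_sum => k; rewrite -val_eqE /eps_ /= => /negPf ->.
  by rewrite sumr_const card_ord -mulr_natr divfK ?gt_eqF// addrC subrK.
have [rho [d [rho0 near_dec]]] := @exists_decoder R T M N eta v (mom P1) (mom P2) xi
  T0 M0 MN NM eta0 v0 momv xi0.
have near_hid := exists_hiding_shift N T0 rho0.
(* Accuracy and hiding both hold for all small positive [s], so a common value exists. *)
have [s [decs hids]] : exists s : R, decoding_error M (d s) s
      (@share_weight R T eta (mom P1) (rho ^+ 2 * mom P2)) <= (eta * v / (eta + v)) ^+ M + xi /\
    forall t : 'I_T -> 'I_N, exists z : 'I_T -> R, (forall k, `|z k| <= 1) /\
      forall j, \sum_k z k * share_coef rho (node s (t j)) k = 1.
  near (0 : R)^'+ => s; exists s; split; near: s; [exact: near_dec|exact: near_hid].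
have [|||||d1 [Om1 [Q [X [mX intX covX shiftX]]]]] :=
  @exists_noise_family R T mu var eps_; rewrite /mu /var /eps_.
- by move=> k; case: eqP.
- by move=> k; case: eqP.
- by move=> k; case: eqP.
- by move=> k; case: eqP.
- by move=> k; case: eqP => _; rewrite fineK ?integrable_fin_num.
have [d2 [Om [P [Y [mY intY shiftY]]]]] := exists_product_space (fun _ : 'I_M => Q).
exists d2, Om, P, (scheme_noise (N := N) rho s X Y), (d s).
split; first exact: (scheme_noise_valid N rho s mX intX mY intY).
split.
  apply: (scheme_noise_DP mX mY) shiftY hids => z z1.
  have [t [mt Xt Pt]] := shiftX z z1.
  exists t; split=> // S mS; apply: le_trans (Pt S mS) _.
  by rewrite lee_wpmul2r// lee_fin ler_expR.
apply: ge_ereal_sup => _ [dA [OmA [PA [A [validA ->]]]]].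
have var0 k : 0 <= var k by rewrite /var; case: ifP.
apply: le_trans (scheme_mse_le rho s mX intX covX var0 mY intY (d s) validA) _.
rewrite lee_fin.
have -> : eta ^+ M / (1 + SNR_star eta eps) ^+ M = (eta * v / (eta + v)) ^+ M.
  rewrite -exprVn -exprMn; congr (_ ^+ _); rewrite /SNR_star -/v; field.
  by rewrite !gt_eqF ?addr_gt0.
apply: le_trans decs.
rewrite le_eqVlt; apply/orP; left; apply/eqP; apply: eq_bigr => f _.
congr (_ * _); apply: eq_bigr => i _.
case: (f i) => [k|]//=; rewrite /scale /var.
by case: eqP => _; rewrite ?expr1n ?mul1r.
Unshelve. all: by end_near.
Qed.
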